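(* Let $V$ be a set of $n$ points in a metric space with doubling dimension $d$, let $\alpha>0$ and $0\le\varepsilon\le1$, and let $V=V_0\supseteq V_1\supseteq\cdots\supseteq V_m$ ($m\ge1$) be the sequence of nets described in the context, with nearest-point maps $\pi_k:V_k\to V_{k+1}$ and graph induced complexes $\mathcal G^r(V_0,V_k)$. Then the persistence diagram of the Rips filtration $$\mathcal R^\alpha(V)\hookrightarrow\mathcal R^{(1+\varepsilon)\alpha}(V)\hookrightarrow\cdots\hookrightarrow\mathcal R^{(1+\varepsilon)^m\alpha}(V)$$ is $\frac{3\log(1+\varepsilon)}{2}$-approximated (at the log-scale) by the persistence diagram of the sequence of simplicial maps $$\mathcal G^\alpha(V_0,V_1)\stackrel{f_1}{\longrightarrow}\mathcal G^{\alpha(1+\varepsilon)}(V_0,V_2)\stackrel{f_2}{\longrightarrow}\cdots\stackrel{f_{m-1}}{\longrightarrow}\mathcal G^{\alpha(1+\varepsilon)^{m-1}}(V_0,V_m),$$ where $f_k$ is induced by $\pi_k$. Moreover, for every $p\ge0$, the $p$-skeleton of each simplicial complex in the latter sequence has size $O\left((\tfrac1\varepsilon)^{O(dp)}\,n\right)$.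
   Context: Homology is simplicial homology with $\mathbb{Z}_2$ coefficients. $D$ denotes the metric. The doubling dimension of a metric space is the smallest $d$ such that every ball of radius $r$ can be covered by at most $2^d$ balls of radius $r/2$. For a finite point set $W$, the Rips complex $\mathcal R^r(W)$ has as simplices the subsets $\{u_0,\dots,u_k\}\subseteq W$ with $D(u_i,u_j)\le r$ for all $i,j$. A subset $W'\subseteq W$ is a $\delta$-net of $W$ if (i) for every $w\in W$ there is $w'\in W'$ with $D(w,w')\le\delta$, and (ii) no two distinct points of $W'$ are within distance $\delta$ of each other. Set $V_0:=V$ and let $V_{k+1}$ be a $\frac{\alpha\varepsilon^2}{2}(1+\varepsilon)^{k-1}$-net of $V_k$, $k=0,\dots,m-1$. The map $\pi_k:V_k\to V_{k+1}$ sends $v$ to a point of $V_{k+1}$ closest to $v$, and $\hat\pi_k:=\pi_k\circ\cdots\circ\pi_0:V_0\to V_{k+1}$. Graph induced complex: given a graph $G(V)$ on vertex set $V$ and a vertex map $\nu:V\to V'$ with $\nu(V)=V'\subseteq V$, the graph induced complex $\mathcal G(G(V),V',\nu)$ is the simplicial complex in which $\{v_1',\dots,v_{k+1}'\}\subseteq V'$ is a $k$-simplex if and only if there is a $(k+1)$-clique $\{v_1,\dots,v_{k+1}\}$ of $G(V)$ with $\nu(v_i)=v_i'$ for each $i$. For $k\ge1$, $\mathcal G^r(V_0,V_k)$ denotes $\mathcal G(G(V_0),V_k,\hat\pi_{k-1})$ with base graph $G(V_0)$ the $1$-skeleton of $\mathcal R^r(V_0)$. The vertex map $\pi_k$ induces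 a well-defined simplicial map $f_k:\mathcal G^{\alpha(1+\varepsilon)^{k-1}}(V_0,V_k)\to\mathcal G^{\alpha(1+\varepsilon)^k}(V_0,V_{k+1})$. Persistence diagrams at the log-scale: for a finite sequence of complexes $X_0\to X_1\to\cdots\to X_N$ where $X_k$ is placed at scale $\alpha(1+\varepsilon)^k$ (here $X_k=\mathcal R^{\alpha(1+\varepsilon)^k}(V)$, $N=m$, respectively $X_k=\mathcal G^{\alpha(1+\varepsilon)^k}(V_0,V_{k+1})$, $N=m-1$), and each homology degree, decompose the persistence module $H_*(X_0)\to\cdots\to H_*(X_N)$ into interval modules; a summand supported on indices $b,b+1,\dots,e$ contributes the point $\left(\log\alpha(1+\varepsilon)^b,\ \log\alpha(1+\varepsilon)^{e+1}\right)$ (the module is regarded as zero outside the indices $0,\dots,N$). A diagram $c$-approximates another if, in each homology degree, their bottleneck distance is at most $c$. In the size bound, the exponent $O(dp)$ is at most an absolute constant times $dp$, the outer $O$ hides a factor depending only on $d$ and $p$, and the bound is vacuous when $\varepsilon=0$. *)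

(* Defs.v *)
From HB Require Import structures.
From mathcomp Require Import all_boot all_order all_algebra.
From mathcomp Require Import generic_quotient ring_quotient.
Set Implicit Arguments.
Unset Strict Implicit.
Unset Printing Implicit Defensive.
Import Order.TTheory GRing.Theory Num.Theory.

Local Open Scope ring_scope.

(* Quotient U / W of subspaces of a finite-dimensional space (U / (U :&: W)
   if W is not contained in U). *)
Section QuotientSpace.
Variables (F : fieldType) (C : vectType F) (U W : {vspace C}).

Definition mod_pred : {pred subvs_of U} := [pred x | vsval x \in W].

Lemma mod_pred_zmod_closed : zmod_closed mod_pred.
Proof.
split=> [|x y]; rewrite !inE ?linear0 ?mem0v // linearB /= => xW yW.
exact: rpredB.
Qed.
HB.instance Definition _ :=
  GRing.isZmodClosed.Build (subvs_of U) mod_pred mod_pred_zmod_closed.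

Definition quotv := Quotient.quot mod_pred.
HB.instance Definition _ := GRing.Zmodule.on quotv.

Definition to_quotv (x : subvs_of U) : quotv := (\pi_(quotv) x)%qT.
Definition of_quotv (x : quotv) : subvs_of U := repr x.

Lemma of_quotvK : cancel of_quotv to_quotv.
Proof. exact: reprK. Qed.

Lemma to_quotv_eq x y : (to_quotv x == to_quotv y) = (vsval x - vsval y \in W).
Proof.
rewrite /to_quotv -(Quotient.idealrBE mod_pred).
by rewrite inE.
Qed.

Lemma to_quotvD x y : to_quotv (x + y) = to_quotv x + to_quotv y.
Proof. by rewrite /to_quotv raddfD. Qed.

Definition quotv_scale (a : F) (x : quotv) := to_quotv (a *: of_quotv x).

Lemma to_quotvZ a x : quotv_scale a (to_quotv x) = to_quotv (a *: x).
Proof.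
apply/eqP; rewrite to_quotv_eq.
have -> : vsval (a *: of_quotv (to_quotv x)) - vsval (a *: x) =
          a *: (vsval (of_quotv (to_quotv x)) - vsval x).
  by rewrite scalerBr -!linearZ.
by apply: memvZ; rewrite -to_quotv_eq of_quotvK.
Qed.

Fact quotv_scaleA a b v : quotv_scale a (quotv_scale b v) = quotv_scale (a * b) v.
Proof. by rewrite -[v]of_quotvK !to_quotvZ scalerA. Qed.
Fact quotv_scale1 : left_id 1 quotv_scale.
Proof. by move=> v; rewrite -[v]of_quotvK to_quotvZ scale1r. Qed.
Fact quotv_scaleDr : right_distributive quotv_scale +%R.
Proof.
move=> a u v; rewrite -[u]of_quotvK -[v]of_quotvK -to_quotvD !to_quotvZ.
by rewrite -to_quotvD scalerDr.
Qed.
Fact quotv_scaleDl v : {morph quotv_scale^~ v : a b / a + b}.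
Proof.
by move=> a b; rewrite -[v]of_quotvK !to_quotvZ -to_quotvD scalerDl.
Qed.
HB.instance Definition _ := GRing.Zmodule_isLmodule.Build F quotv
  quotv_scaleA quotv_scale1 quotv_scaleDr quotv_scaleDl.

End QuotientSpace.


(* Only the part indexed by 0, ..., N matters for a module with N + 1 terms;
   N is passed separately to pm_iso and is_barcode. *)
Record pmodule (F : fieldType) := PModule {
  pm_space : nat -> lmodType F;
  pm_map : forall k, {linear pm_space k -> pm_space k.+1}
}.

Definition bar_active (s : seq (nat * nat)) k (j : 'I_(size s)) : bool :=
  let be := nth (0, 0)%N s j in (be.1 <= k <= be.2)%N.

(* The direct sum of the interval modules of the bars (b, e) in s, each
   supported on the indices b, ..., e (e included): in degree k it is F^A with
   A the set of bars active at k, and a bar is mapped identically from k to k.+1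
   when it is active at both and to 0 otherwise. *)
Section IntervalSum.
Variables (F : fieldType) (s : seq (nat * nat)).

Definition interval_space (k : nat) : lmodType F :=
  {ffun {j : 'I_(size s) | bar_active k j} -> F^o}.

Definition interval_map k (u : interval_space k) : interval_space k.+1 :=
  [ffun j => if insub (val j) is Some i then u i else 0].

Lemma interval_map_linear k : linear (@interval_map k).
Proof.
move=> a u v; apply/ffunP=> j; rewrite !ffunE.
by case: insubP => [i _ _|_]; rewrite ?ffunE ?scaler0 ?addr0.
Qed.
HB.instance Definition _ k :=
  GRing.isLinear.Build F (interval_space k) (interval_space k.+1) _
    (@interval_map k) (@interval_map_linear k).

Definition interval_sum : pmodule F :=
  @PModule F interval_space (fun k => @interval_map k).

End IntervalSum.

Definition pm_iso (F : fieldType) (N : nat) (M M' : pmodule F) : Prop :=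
  exists phi : forall k, {linear pm_space M k -> pm_space M' k},
    (forall k, (k <= N)%N -> bijective (phi k)) /\
    (forall k, (k < N)%N -> forall x,
       phi k.+1 (pm_map M k x) = pm_map M' k (phi k x)).

Definition is_barcode (F : fieldType) N (M : pmodule F) (s : seq (nat * nat)) :=
  (forall be, be \in s -> (be.1 <= be.2 <= N)%N) /\
  pm_iso N M (interval_sum F s).

Section Homology.
Variable T : finType.
Implicit Types (K L : {set {set T}}) (f : T -> T) (p : nat).

Definition simplicial f K L : bool := [forall s in K, [set f x | x in s] \in L].

Definition skeleton p K : {set {set T}} := [set s in K | (#|s| <= p.+1)%N].

(* The Z_2-vector space on all subsets of T; the chain groups of a complex on
   T are the subspaces spanned by its simplices of a given dimension. *)
Definition chain : vectType 'F_2 := {ffun {set T} -> ('F_2)^o}.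

Definition elt_chain (s : {set T}) : chain := [ffun t => (t == s)%:R].

Definition chains K p : {vspace chain} :=
  <<[seq elt_chain s | s in [set s in K | #|s| == p.+1]]>>%VS.

(* The coefficient of a nonempty t in the boundary of c is the sum of the
   coefficients in c of the simplices of which t is a facet; the empty face is
   dropped since homology is not reduced. *)
Definition boundary_fun (c : chain) : chain :=
  [ffun t : {set T} =>
     if t == set0 then 0 else \sum_(v | v \notin t) c (v |: t)].

Lemma boundary_linear : linear boundary_fun.
Proof.
move=> a u v; apply/ffunP=> t; rewrite !ffunE; case: ifP => _.
  by rewrite scaler0 addr0.
rewrite scaler_sumr -big_split; apply: eq_bigr => x _.
by rewrite !ffunE.
Qed.
HB.instance Definition _ :=
  GRing.isLinear.Build 'F_2 chain chain _ boundary_fun boundary_linear.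

Definition boundary : 'End(chain) := linfun boundary_fun.

(* Simplices collapsed by f to a lower dimension are sent to 0. *)
Definition push_fun f (c : chain) : chain :=
  [ffun t : {set T} =>
    \sum_(s : {set T} | ([set f x | x in s] == t) && (#|s| == #|t|)) c s].

Lemma push_linear f : linear (push_fun f).
Proof.
move=> a u v; apply/ffunP=> t; rewrite !ffunE scaler_sumr -big_split.
by apply: eq_bigr => x _; rewrite !ffunE.
Qed.
HB.instance Definition _ f :=
  GRing.isLinear.Build 'F_2 chain chain _ (push_fun f) (push_linear f).

Definition push f : 'End(chain) := linfun (push_fun f).

Definition cycles K p : {vspace chain} := (chains K p :&: lker boundary)%VS.
Definition boundaries K p : {vspace chain} := (boundary @: chains K p.+1)%VS.

Definition homology K p : lmodType 'F_2 := quotv (cycles K p) (boundaries K p).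

(* The class of a cycle z goes to that of push f z, see hmap_funE. The value 0
   for a vertex map that is not simplicial is a dummy that makes hmap_fun linear
   without side condition. *)
Definition hmap_fun f K L p (h : homology K p) : homology L p :=
  if simplicial f K L then
    to_quotv (boundaries L p)
      (vsproj (cycles L p) (push f (vsval (of_quotv h))))
  else 0.
Arguments hmap_fun : clear implicits.

Lemma chainsP K p (c : chain) :
  reflect (forall s, c s != 0 -> (s \in K) && (#|s| == p.+1)) (c \in chains K p).
Proof.
apply: (iffP idP) => [/coord_span ->|h] => [s|].
  rewrite sum_ffunE => /eqP ns0; apply/negPn/negP => sK; apply: ns0.
  apply: big1 => i _; rewrite ffunE.
  pose X := [seq elt_chain s | s in [set s in K | #|s| == p.+1]].
  have /imageP[t] : nth 0 X i \in X by rewrite mem_nth ?size_image.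
  rewrite inE => tK ->; rewrite ffunE.
  case: eqP => [st|_]; last by rewrite scaler0.
  by rewrite st tK in sK.
rewrite (_ : c = \sum_(s in [set s in K | #|s| == p.+1]) c s *: elt_chain s).
  apply: memv_suml => s sK; apply: memvZ; apply: memv_span.
  by apply: map_f; rewrite mem_enum.
apply/ffunP=> t; rewrite sum_ffunE; case: (eqVneq (c t) 0) => [ct|ct].
  rewrite ct big1 // => s _; rewrite !ffunE.
  by case: eqP => [<-|]; rewrite ?ct ?scale0r ?scaler0.
rewrite (bigD1 t) /=; last by rewrite inE h.
rewrite big1 ?addr0 => [|s /andP[_ st]]; rewrite !ffunE.
  by rewrite eqxx; apply/esym/mulr1.
by rewrite eq_sym (negPf st) scaler0.
Qed.

Lemma boundaryE (c : chain) (t : {set T}) : t != set0 ->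
  boundary c t = \sum_(v | v \notin t) c (v |: t).
Proof. by move=> t0; rewrite lfunE /= ffunE (negPf t0). Qed.

Lemma boundary0E (c : chain) : boundary c set0 = 0.
Proof. by rewrite lfunE /= ffunE eqxx. Qed.

Lemma pushE f (c : chain) (t : {set T}) : push f c t =
  \sum_(s : {set T} | ([set f x | x in s] == t) && (#|s| == #|t|)) c s.
Proof. by rewrite lfunE /= ffunE. Qed.

Lemma count_facets f (s t : {set T}) :
  odd #|[set u in s | ([set f x | x in s :\ u] == t) && (#|s :\ u| == #|t|)]| =
  odd #|[set w | (w \notin t) &&
                 (([set f x | x in s] == w |: t) && (#|s| == #|w |: t|))]|.
Proof.
set A := finset (fun u => _); set B := finset (fun w => _).
case: (eqVneq #|s| #|t|.+1) => [st|st]; last first.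
  have -> : A = set0.
    apply/setP=> u; rewrite !inE; apply/negbTE/negP => /and3P[us _].
    by rewrite -(eqn_add2l 1) -[X in (_ + _ == X)%N -> _]/(#|t|.+1) => /eqP e;
      move: st; rewrite (cardsD1 u) us e eqxx.
  have -> : B = set0 => //.
  apply/setP=> w; rewrite !inE; apply/negbTE/negP => /and3P[wt _].
  by rewrite cardsU1 wt add1n (negPf st).
have cA u : u \in s -> #|s :\ u| = #|t|.
  by move=> us; move: st; rewrite (cardsD1 u) us => -[].
have imD u : u \in s -> [set f x | x in s] = f u |: [set f x | x in s :\ u].
  by move=> us; rewrite -{1}(setD1K us) imsetU1.
case: (eqVneq [set f x | x in s] t) => [fst|fst].
  have -> : B = set0.
    apply/setP=> w; rewrite !inE fst; apply/negbTE/negP => /and3P[wt /eqP tw _].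
    by rewrite tw !inE eqxx in wt.
  have /dinjectivePn[a as_ [b]] : ~~ dinjectiveb f (mem s).
    apply/negP => /dinjectiveP /card_in_imset; rewrite fst st => /eqP.
    by rewrite -[X in X == _]addn0 -addn1 eqn_add2l.
  rewrite inE /= => /andP[ba bs] fab; rewrite cards0.
  have fD u v : u \in s -> v \in s -> v != u -> f u = f v ->
      [set f x | x in s :\ u] = t.
    move=> us vs vu fuv; rewrite -fst (imD u us); apply/esym/setUidPr.
    by rewrite sub1set fuv imset_f // !inE vu.
  have injA : {in s :\ a &, injective f}.
    by apply/imset_injP; rewrite (fD a b) // cA.
  rewrite (_ : A = [set a; b]) ?cards2 1?eq_sym ?ba //.
  apply/setP=> u; rewrite !inE; apply/idP/idP; last first.
    case/orP=> /eqP ->; first by rewrite as_ (fD a b) // cA ?eqxx.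
    by rewrite bs (fD b a) // 1?eq_sym // cA ?eqxx.
  case/and3P=> us /eqP fu _; case: (eqVneq u a) => //= ua.
  have : f u \in [set f x | x in s :\ u] by rewrite fu -fst imset_f.
  case/imsetP=> v; rewrite !inE => /andP[vu vs] fuv.
  case: (eqVneq v a) => [va|va].
    by apply/eqP/injA; rewrite ?inE ?us ?ua ?bs ?ba // fuv va.
  by rewrite (injA u v) ?eqxx ?inE ?us ?vs ?ua ?va // in vu *.
case: (pickP (mem B)) => [w|B0].
  rewrite !inE => /and3P[wt /eqP fw cw].
  have injs : {in s &, injective f}.
    by apply/imset_injP; rewrite fw eq_sym.
  have -> : B = [set w].
    apply/setP=> v; rewrite !inE fw; apply/idP/eqP => [/and3P[vt /eqP wv _]|->].
      have : v \in w |: t by rewrite wv !inE eqxx.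
      by rewrite !inE (negPf vt) orbF => /eqP.
    by rewrite wt eqxx -fw /= fw.
  have /imsetP[u us fu] : w \in [set f x | x in s] by rewrite fw !inE eqxx.
  rewrite (_ : A = [set u]) ?cards1 //.
  apply/setP=> v; rewrite !inE; apply/idP/eqP => [/and3P[vs /eqP fv _]|->].
    apply: injs => //; rewrite -fu.
    have : f v |: t = w |: t by rewrite -fw (imD v vs) fv.
    move/setP/(_ w); rewrite !inE eqxx (negPf wt) orbF /=.
    by move/eqP.
  rewrite us cA // eqxx andbT /=; apply/eqP/setP=> x.
  have nfu : f u \notin [set f x | x in s :\ u].
    apply/imsetP=> -[y]; rewrite !inE => /andP[yu ys] /injs yy.
    by rewrite yy ?eqxx // in yu.
  move: fw; rewrite (imD u us) -fu => /setP/(_ x); rewrite !inE -fu in nfu *.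
  case: (eqVneq x w) => [->|//] _.
  by rewrite (negPf nfu) (negPf wt).
have -> : B = set0 by apply/setP=> w; have := B0 w; rewrite !inE.
have -> // : A = set0.
apply/setP=> u; rewrite !inE; apply/negbTE/negP => /and3P[us /eqP fu _].
have fs := imD u us; rewrite fu in fs.
case: (boolP (f u \in t)) => fut.
  move: fst; rewrite fs; have /setUidPr -> : [set f u] \subset t by rewrite sub1set.
  by rewrite eqxx.
by have := B0 (f u); rewrite !inE fut fs eqxx cardsU1 fut st eqxx.
Qed.

Lemma push_boundary f (c : chain) : push f (boundary c) = boundary (push f c).
Proof.
apply/ffunP=> t; rewrite pushE; case: (eqVneq t set0) => [->|t0].
  rewrite boundary0E big1 // => s; rewrite cards0 cards_eq0 => /andP[_ /eqP ->].
  exact: boundary0E.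
have F2 (x : 'F_2) n : x *+ n = x *+ odd n.
  rewrite -[in LHS](odd_double_half n) mulrnDr -mul2n mulrnA.
  by rewrite -[x *+ 2]mulr_natl pchar_Fp_0 // mul0r mul0rn addr0.
pose P (s : {set T}) := ([set f x | x in s] == t) && (#|s| == #|t|).
transitivity (\sum_(s : {set T}) \sum_(u in s | P (s :\ u)) c s).
  transitivity (\sum_(s | P s) \sum_(v | v \notin s) c (v |: s)).
    apply: eq_bigr => s /andP[_ st]; apply: boundaryE.
    by rewrite -cards_eq0 (eqP st) cards_eq0.
  rewrite pair_big_dep [RHS]pair_big_dep /=.
  rewrite (reindex_onto (fun q : {set T} * T => (q.1 :\ q.2, q.2))
                        (fun q : {set T} * T => (q.2 |: q.1, q.2))) /=.
    apply: eq_big => [[s u]|[s u] /andP[_ /eqP [e]]] /=; last by rewrite e.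
    rewrite !inE eqxx /= andbT andbC; case: (boolP (u \in s)) => us /=.
      by rewrite setD1K // eqxx.
    by apply/negbTE/negP => /andP[/eqP[e] _]; rewrite -e !inE eqxx in us.
  by move=> [s u] /= /andP[_ us]; rewrite setU1K.
transitivity (\sum_(w | w \notin t) \sum_(s : {set T} |
   ([set f x | x in s] == w |: t) && (#|s| == #|w |: t|)) c s); last first.
  by rewrite boundaryE //; apply: eq_bigr => w _; rewrite pushE.
rewrite [RHS](exchange_big_dep predT) //=; apply: eq_bigr => s _.
rewrite !sumr_const F2 [RHS]F2 /P.
have := count_facets f s t; rewrite !cardsE => ->.
by [].
Qed.

Lemma push_chains f K L p c :
  simplicial f K L -> c \in chains K p -> push f c \in chains L p.
Proof.
move=> /forallP fKL /chainsP cK; apply/chainsP=> t; rewrite pushE => nz.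
have /existsP[s /and3P[/andP[/eqP fs /eqP st] cs _]] : [exists s : {set T},
    [&& ([set f x | x in s] == t) && (#|s| == #|t|), c s != 0 & true]].
  apply/contraR: nz => /existsPn h; apply/eqP/big1 => s st.
  by have := h s; rewrite st andbT /= negbK => /eqP.
have /andP[sK sp] := cK s cs.
by rewrite -st sp andbT -fs; have := fKL s; rewrite sK.
Qed.

Lemma push_cycles f K L p c :
  simplicial f K L -> c \in cycles K p -> push f c \in cycles L p.
Proof.
move=> fKL; rewrite !memv_cap => /andP[cK]; rewrite !memv_ker => /eqP c0.
by rewrite (push_chains fKL cK) -push_boundary c0 linear0 /=.
Qed.

Lemma push_boundaries f K L p c :
  simplicial f K L -> c \in boundaries K p -> push f c \in boundaries L p.
Proof.
move=> fKL /memv_imgP[b bK ->]; rewrite push_boundary.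
exact/memv_img/(push_chains fKL).
Qed.

Lemma hmap_funE f K L p (z : subvs_of (cycles K p)) : simplicial f K L ->
  hmap_fun f K L p (to_quotv (boundaries K p) z) =
  to_quotv (boundaries L p) (vsproj (cycles L p) (push f (vsval z))).
Proof.
move=> fKL; rewrite /hmap_fun fKL; apply/eqP.
rewrite to_quotv_eq !vsprojK ?(push_cycles fKL) ?subvsP // -linearB.
by apply: (push_boundaries fKL); rewrite -to_quotv_eq of_quotvK.
Qed.

Lemma hmap_linear f K L p : linear (hmap_fun f K L p).
Proof.
move=> a u v; rewrite -[u]of_quotvK -[v]of_quotvK.
rewrite -[a *: to_quotv _ _]/(quotv_scale a _) to_quotvZ -to_quotvD.
case: (boolP (simplicial f K L)) => fKL; last first.
  by rewrite /hmap_fun (negPf fKL) scaler0 addr0.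
rewrite !hmap_funE // -[a *: to_quotv _ _]/(quotv_scale a _) to_quotvZ.
by rewrite -to_quotvD !linearP.
Qed.
HB.instance Definition _ f K L p :=
  GRing.isLinear.Build 'F_2 (homology K p) (homology L p) _
    (hmap_fun f K L p) (@hmap_linear f K L p).

Definition hmap f K L p : {linear homology K p -> homology L p} :=
  hmap_fun f K L p.

(* The persistence module H_p(X 0) -> H_p(X 1) -> ... of a sequence of
   complexes and vertex maps, f k : X k -> X k.+1. *)
Definition homology_pmodule (X : nat -> {set {set T}}) (f : nat -> T -> T) p :
    pmodule 'F_2 :=
  @PModule 'F_2 (fun k => homology (X k) p)
    (fun k => hmap (f k) (X k) (X k.+1) p).

Definition one_skeleton_graph K : rel T :=
  fun u v => (u != v) && ([set u; v] \in K).

Definition clique (e : rel T) (s : {set T}) : bool :=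
  [forall u in s, forall v in s, (u != v) ==> e u v].

Definition graph_induced_complex (e : rel T) (V' : {set T}) (nu : T -> T) :
    {set {set T}} :=
  [set s : {set T} | [&& s != set0, s \subset V' &
    [exists t : {set T},
      [&& clique e t, #|t| == #|s| & [set nu v | v in t] == s]]]].

Lemma simplicial_gic (e e' : rel T) (V' V'' : {set T}) (nu g : T -> T) :
  subrel e e' -> {in V', forall v, g v \in V''} ->
  simplicial g (graph_induced_complex e V' nu)
               (graph_induced_complex e' V'' (g \o nu)).
Proof.
move=> ee' gV; apply/forallP=> s; apply/implyP; rewrite !inE.
case/and3P=> s0 /subsetP sV /existsP[t /and3P[cl /eqP ts /eqP nus]].
apply/and3P; split.
- by rewrite -cards_eq0 cards_eq0 imset_eq0.
- by apply/subsetP=> _ /imsetP[v vs ->]; apply/gV/sV.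
pose r w := odflt w [pick v in t | (g \o nu) v == w].
have rP w : w \in [set g x | x in s] -> (r w \in t) /\ (g \o nu) (r w) = w.
  rewrite -nus => /imsetP[_ /imsetP[v vt ->] ->]; rewrite /r.
  case: pickP => [x /andP[xt /eqP]|/(_ v)] //=.
  by rewrite vt eqxx.
apply/existsP; exists [set r w | w in [set g x | x in s]].
apply/and3P; split.
- apply/forall_inP=> u /imsetP[x /rP[xt _] ->]; apply/forall_inP=> v.
  move=> /imsetP[y /rP[yt _] ->]; apply/implyP=> xy; apply: ee'.
  by move/forall_inP: cl => /(_ _ xt)/forall_inP/(_ _ yt)/implyP; apply.
- rewrite card_in_imset // => x y /rP[_ ex] /rP[_ ey] e12.
  by rewrite -ex -ey e12.
- rewrite -imset_comp; apply/eqP/setP=> w.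
  apply/imsetP/idP => [[x xs ->]|ws]; first by have [_ /= ->] := rP x xs.
  by exists w => //=; have [_ /= ->] := rP w ws.
Qed.

End Homology.

From mathcomp Require Import all_classical all_reals all_analysis finmap.

Local Open Scope ring_scope.

Section Diagrams.
Variable R : realType.
Implicit Types (D : seq (R * R)) (x y : R * R) (delta : R).

Definition linfty x y : R := Num.max `|x.1 - y.1| `|x.2 - y.2|.

Definition diagonal_dist x : R := `|x.2 - x.1| / 2.

(* A partial matching of D and D', given by positions so that multiplicities
   count; leaving a point unmatched amounts to matching it to its nearest
   point on the diagonal. *)
Definition delta_matching delta D D' : Prop :=
  exists mu : {set 'I_(size D) * 'I_(size D')},
    [/\ {in mu &, injective fst}, {in mu &, injective snd},
        forall i j, (i, j) \in mu ->
          linfty (nth (0, 0) D i) (nth (0, 0) D' j) <= delta,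
        forall i, (forall j, (i, j) \notin mu) ->
          diagonal_dist (nth (0, 0) D i) <= delta
      & forall j, (forall i, (i, j) \notin mu) ->
          diagonal_dist (nth (0, 0) D' j) <= delta].

Definition bottleneck D D' : R :=
  inf (fun delta => 0 <= delta /\ delta_matching delta D D').

Definition log_points (scale : nat -> R) (s : seq (nat * nat)) : seq (R * R) :=
  [seq (ln (scale be.1), ln (scale be.2.+1)) | be <- s].

Definition is_log_diagram (F : fieldType) (scale : nat -> R) N
    (M : pmodule F) D : Prop :=
  exists2 s, is_barcode N M s & D = log_points scale s.

(* Barcodes are unique up to order, so the diagrams are well defined as
   multisets; the first two clauses state that they exist. *)
Definition log_approximated (F : fieldType) (scale : nat -> R) (c : R)
    N (M : nat -> pmodule F) N' (M' : nat -> pmodule F) : Prop :=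
  forall q,
    [/\ exists D, is_log_diagram scale N (M q) D,
        exists D', is_log_diagram scale N' (M' q) D'
      & forall D D', is_log_diagram scale N (M q) D ->
          is_log_diagram scale N' (M' q) D' -> bottleneck D D' <= c].

End Diagrams.

Section Metric.
Variables (R : realType) (X : metricType R).

Definition half_coverable (d : R) : Prop :=
  forall (x : X) (r : R), 0 < r ->
    exists s : seq X, (size s)%:R <= 2 `^ d /\
      forall z, ball x r z -> exists2 y, y \in s & ball y (r / 2) z.

(* 0 <= d only matters for the empty space. *)
Definition doubling_dimension (d : R) : Prop :=
  [/\ 0 <= d, half_coverable d &
      forall d', 0 <= d' -> half_coverable d' -> d <= d'].

Variable V : {fset X}.
Implicit Types (u v w : V) (W : {set V}) (r delta : R).

Definition pdist u v : R := mdist (val u) (val v).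

Definition rips r : {set {set V}} :=
  [set s : {set V} | (s != finset.set0) &&
                     [forall u in s, forall v in s, pdist u v <= r]].

Definition is_net delta W' W : Prop :=
  [/\ W' \subset W,
      forall w, w \in W -> exists2 w', w' \in W' & pdist w w' <= delta
    & forall u v, u \in W' -> v \in W' -> u != v -> delta < pdist u v].

Definition nearest_point_map W W' (pi : V -> V) : Prop :=
  forall v, v \in W ->
    pi v \in W' /\ forall w, w \in W' -> pdist v (pi v) <= pdist v w.

Fixpoint pi_hat (pi : nat -> V -> V) (k : nat) : V -> V :=
  if k is k'.+1 then pi k \o pi_hat pi k' else pi 0%N.

(* G^r(V_0, V_k), for k >= 1. *)
Definition nets_gic (W : nat -> {set V}) (pi : nat -> V -> V) r k :
    {set {set V}} :=
  graph_induced_complex (one_skeleton_graph (rips r)) (W k) (pi_hat pi k.-1).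

(* The vertex maps pi_(k+1) inducing
   f_(k+1) : G^(r k)(V_0, V_(k+1)) -> G^(r k.+1)(V_0, V_(k+2)) are simplicial. *)
Lemma simplicial_nets_gic (W : nat -> {set V}) pi r r' k : r <= r' ->
  {in W k.+1, forall v, pi k.+1 v \in W k.+2} ->
  simplicial (pi k.+1) (nets_gic W pi r k.+1) (nets_gic W pi r' k.+2).
Proof.
move=> rr'; apply: simplicial_gic => u v /andP[uv]; rewrite inE => /andP[_ uvr].
rewrite /one_skeleton_graph uv inE -cards_eq0 cards2 uv /=.
apply/forall_inP=> x xs; apply/forall_inP=> y ys; apply: le_trans rr'.
by move/forall_inP: uvr => /(_ _ xs)/forall_inP/(_ _ ys).
Qed.

Lemma simplicial_rips r r' : r <= r' -> simplicial id (rips r) (rips r').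
Proof.
move=> rr'; apply/forall_inP=> s; rewrite imset_id !inE => /andP[-> /=].
move=> /forall_inP sr; apply/forall_inP=> x xs; apply/forall_inP=> y ys.
by apply: le_trans rr'; move/forall_inP: (sr _ xs) => /(_ _ ys).
Qed.

End Metric.

Definition log_scale (R : realType) (alpha eps : R) (k : nat) : R :=
  alpha * (1 + eps) ^+ k.

(* Main.v *)
(* The vertex maps pi_hat k : Rips_k -> G_k and the inclusions G_k -> Rips_(k+1)
   (which exist because pi_hat k moves points by at most eps/2 times the scale)
   interleave the two sequences into a single one,
     Rips_0 -> G_0 -> Rips_1 -> G_1 -> ... -> G_(m-1) -> Rips_m.
   Going from Rips to Rips, the composite is contiguous to the inclusion; going
   from G to G, it is f_k, because pi_hat k is the identity on V_(k+1).  Hence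
   both persistence modules are obtained from one module with 2m+1 terms by
   keeping the even, resp. the odd, indices, and each interval summand [b, e] of
   it yields intervals whose ends differ by at most one step.
   For the size, the vertices of a simplex of G_k are at distance at most
   alpha (1 + eps)^(k+1) from each other and lie in a net of radius smaller by a
   factor of order eps^2, so halving balls O(log (1/eps)) times leaves
   (1/eps)^O(d) candidate neighbours for each vertex. *)
Require Import Defs.
From HB Require Import structures.
From mathcomp Require Import all_boot all_order all_algebra.
Set Implicit Arguments.
Unset Strict Implicit.
Unset Printing Implicit Defensive.
Import Order.TTheory GRing.Theory Num.Theory.
Local Open Scope ring_scope.

(** * Contiguous vertex maps *)

Section Contiguity.
Variable T : finType.
Implicit Types (K L : {set {set T}}) (f g : T -> T) (p : nat) (c : chain T).

Lemma F2_addrr (x : 'F_2) : x + x = 0.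
Proof. by rewrite -mulr2n -mulr_natl pchar_Fp_0 // mul0r. Qed.

Lemma F2_oppr (x : 'F_2) : - x = x.
Proof. by apply/eqP; rewrite -subr_eq0 -opprD F2_addrr oppr0. Qed.

(** The join with [a]. Simplices of [c] that already contain [a] are dropped, being degenerate in
    the join. *)
Definition cone (a : T) (c : chain T) : chain T :=
  [ffun t : {set T} => if a \in t then c (t :\ a) else 0].

(* Unlike [boundary], this keeps the empty face; it makes [cone a] a
   contracting homotopy in every degree. *)
Definition aug_boundary (c : chain T) : chain T :=
  [ffun t : {set T} => \sum_(v | v \notin t) c (v |: t)].

Lemma boundary_aug c t : t != set0 -> boundary T c t = aug_boundary c t.
Proof. by move=> t0; rewrite boundaryE // ffunE. Qed.

(** The facet of [a |: s] opposite [a] is [s], and its other facets are cones over facets of [s].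
    For [s] containing [a], the two terms on the right cancel mod 2. *)
Lemma aug_boundary_cone a c :
  aug_boundary (cone a c) = c + cone a (aug_boundary c).
Proof.
apply/ffunP=> t; rewrite !ffunE; case: (boolP (a \in t)) => at_; last first.
  rewrite addr0 (bigD1 a) //= big1 ?addr0 => [|v /andP[vt va]].
    by rewrite ffunE setU11 setU1K.
  by rewrite ffunE !inE eq_sym (negPf va) (negPf at_).
rewrite [X in _ = _ + X](bigD1 a) /=; last by rewrite !inE eqxx.
rewrite setD1K // addrA F2_addrr add0r.
apply: eq_big => [v|v vt]; first by rewrite !inE; case: eqP => [->|] //=;
  rewrite ?at_ ?andbT ?andbF.
rewrite ffunE !inE at_ orbT; congr (c _); apply/setP=> x; rewrite !inE.
case: (eqVneq x v) => [->|]; rewrite ?orbF ?orbT //.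
by case: eqP vt => // ->; rewrite at_.
Qed.

Definition link (v : T) (c : chain T) : chain T :=
  [ffun t : {set T} => if v \in t then 0 else c (v |: t)].

(** For [t] without [v], the coefficient at [t] equals that of [boundary T c] at [v |: t]. The
    latter set is never empty, so the link is a cycle also at the empty face. *)
Lemma aug_boundary_link_cycle v c : boundary T c = 0 -> aug_boundary (link v c) = 0.
Proof.
move=> c0; apply/ffunP=> t; rewrite !ffunE; case: (boolP (v \in t)) => vt.
  by apply: big1 => u _; rewrite ffunE !inE vt orbT.
have nz : v |: t != set0 by rewrite -cards_eq0 cardsU1 vt.
have := boundaryE c nz; rewrite c0 ffunE => /esym e.
rewrite -[RHS]e (bigD1 v) //= ffunE setU11 add0r.
apply: eq_big => [u|u /andP[ut uv]]; first by rewrite !inE negb_or andbC.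
by rewrite ffunE !inE eq_sym (negPf uv) (negPf vt) /= setUCA.
Qed.

Lemma push_id c : push id c = c.
Proof.
apply/ffunP=> t; rewrite pushE (bigD1 t) /=; last by rewrite imset_id !eqxx.
rewrite big1 ?addr0 // => s; rewrite imset_id => /andP[/andP[/eqP -> _]].
by rewrite eqxx.
Qed.

Lemma eq_push f g c : (forall s, c s != 0 -> {in s, f =1 g}) ->
  push f c = push g c.
Proof.
move=> fg; apply/ffunP=> t; rewrite !pushE big_mkcond [RHS]big_mkcond /=.
apply: eq_bigr => s _; case: (eqVneq (c s) 0) => [->|/fg e]; first by rewrite !if_same.
by rewrite (eq_in_imset e).
Qed.

(** At a nonempty face this is [push_boundary]; at the empty face, pushing preserves the sum of the
    coefficients of the vertices. *)
Lemma push_aug_cycle f c : aug_boundary c = 0 -> aug_boundary (push f c) = 0.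
Proof.
move=> c0; apply/ffunP=> t; rewrite [RHS]ffunE.
case: (eqVneq t set0) => [->|t0]; last first.
  rewrite -boundary_aug // -push_boundary.
  rewrite (_ : boundary T c = 0) ?linear0 ?ffunE //; apply/ffunP=> s.
  case: (eqVneq s set0) => [->|s0]; first by rewrite boundary0E ffunE.
  by rewrite boundary_aug // c0.
have /ffunP/(_ set0) := c0; rewrite !ffunE => e; rewrite -[RHS]e.
transitivity (\sum_(v : T) \sum_(x | f x == v) c [set x]); last first.
  rewrite [RHS](partition_big f predT) //=; apply: eq_bigr => v _.
  by apply: eq_big => [x|x _]; rewrite ?inE ?setU0.
apply: eq_big => [v|v _]; rewrite ?inE // setU0 pushE cards1.
rewrite (reindex_onto (fun x => [set x]) (fun s => odflt v [pick x in s])) /=.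
  apply: eq_bigl => x; rewrite imset_set1 cards1 eqxx andbT.
  case: pickP => [y /set1P->|/(_ x)]; last by rewrite set11.
  rewrite eqxx andbT; apply/eqP/eqP => [/setP/(_ (f x))|->] //.
  by rewrite !inE eqxx => /esym/eqP.
move=> s /andP[_ /cards1P[x ->]]; case: pickP => [y /set1P->|/(_ x)] //.
by rewrite set11.
Qed.

(** A simplex [v |: s] of the star of [v] has a nondegenerate image exactly when the image of [s] is
    nondegenerate and misses [f v]; the star is thus pushed to the cone over the pushed link. *)
Lemma push_star f v c (t : {set T}) :
  \sum_(s : {set T} | ([set f x | x in s] == t) && (#|s| == #|t|) && (v \in s)) c s
  = cone (f v) (push f (link v c)) t.
Proof.
rewrite ffunE; case: ifP => fvt; last first.
  apply: big1 => s /andP[/andP[/eqP fs _] vs].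
  by rewrite -fs imset_f in fvt.
rewrite pushE.
rewrite [RHS](bigID (fun s : {set T} => v \in s)) /=.
rewrite [X in _ = X + _]big1 ?add0r => [|s /andP[_ vs]]; last by rewrite ffunE vs.
rewrite (reindex_onto (fun s : {set T} => v |: s) (fun s => s :\ v)) /=; last first.
  by move=> s /andP[_ vs]; rewrite setD1K.
apply: eq_big => [s|s /andP[_ /eqP <-]]; last first.
  by rewrite ffunE !inE eqxx /= setD1K // !inE eqxx.
have [vs|vs] := boolP (v \in s).
  rewrite andbF; apply/negbTE/negP => /andP[_ /eqP/setP/(_ v)].
  by rewrite !inE eqxx vs.
rewrite setU11 setU1K // eqxx !andbT imsetU1 cardsU1 vs add1n.
rewrite [#|t|](cardsD1 (f v)) fvt eqSS.
case: (eqVneq #|s| _) => e; rewrite ?andbF ?andbT //.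
apply/eqP/eqP => [|->]; last by rewrite setD1K.
(* If [f v] were in the image of [s], that image would be [t], which has one element more than
   [s]. *)
move=> ft; rewrite -ft setU1K //; apply/negP => fvs.
move: e; rewrite -ft (setUidPr _) ?sub1set // => e.
have := leq_imset_card f (mem s); rewrite e.
by rewrite (cardsD1 (f v) [set f x | x in s]) fvs ltnn.
Qed.

Lemma push_split f v c : push f c =
  push f [ffun s : {set T} => if v \in s then 0 else c s]
  + cone (f v) (push f (link v c)).
Proof.
apply/ffunP=> t; rewrite [RHS]ffunE -push_star !pushE.
rewrite (bigID (fun s : {set T} => v \in s)) /= addrC; congr (_ + _).
rewrite big_mkcond [RHS]big_mkcond; apply: eq_bigr => s _; rewrite ffunE.
by case: (v \in s); rewrite ?andbF ?andbT ?if_same.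
Qed.

(* The homotopy sends a cycle c to the join of f v, g v and the image of the link
   of v in c. *)
Lemma contiguous_one_vertex f g v K L p c :
  (forall u, u != v -> f u = g u) ->
  (forall s, s \in K -> [set f x | x in s] :|: [set g x | x in s] \in L) ->
  c \in cycles K p -> push f c - push g c \in boundaries L p.
Proof.
move=> fg KL; rewrite memv_cap => /andP[/chainsP cK]; rewrite memv_ker => /eqP c0.
set w := push f (link v c).
have offv (e : chain T) : (forall s : {set T}, v \in s -> e s = 0) -> push f e = push g e.
  move=> e0; apply: eq_push => s es x xs; apply: fg; apply: contraNneq es => xv.
  by rewrite e0 // -xv.
(* The simplices that avoid [v] cancel, and the link of [v] has the same image [w] under both
   maps. *)
have -> : push f c - push g c = cone (f v) w - cone (g v) w.
  rewrite (push_split f v c) (push_split g v c) -/w.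
  rewrite -(offv [ffun s : {set T} => if v \in s then 0 else c s]); last first.
    by move=> s vs; rewrite ffunE vs.
  rewrite -(offv (link v c)); last by move=> s vs; rewrite ffunE vs.
  by rewrite opprD addrACA subrr add0r.
have dw : aug_boundary w = 0 by apply/push_aug_cycle/aug_boundary_link_cycle.
(* Two uses of the cone formula; the remaining term is a cone over the augmented boundary of [w],
   which is 0. *)
have d : boundary T (cone (f v) (cone (g v) w)) = cone (f v) w - cone (g v) w.
  apply/ffunP=> t; case: (eqVneq t set0) => [->|t0].
    by rewrite boundary0E !ffunE !inE subr0.
  rewrite boundary_aug // aug_boundary_cone aug_boundary_cone dw !ffunE.
  rewrite F2_oppr addrC; congr (_ + _).
  by rewrite if_same addr0.
rewrite -d; apply: memv_img; apply/chainsP=> t; rewrite !ffunE.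
case: ifP => [ft|]; last by rewrite eqxx.
case: ifP => [gt|]; last by rewrite eqxx.
rewrite pushE => nz; have /existsP[s /andP[/andP[/eqP fs /eqP st] ls]] :
  [exists s : {set T}, (([set f x | x in s] == t :\ f v :\ g v) &&
     (#|s| == #|t :\ f v :\ g v|)) && (link v c s != 0)].
  apply: contraR nz => /existsPn h; apply/eqP/big1 => s sP.
  by have := h s; rewrite sP negbK => /eqP.
move: ls; rewrite ffunE; case: ifP => [_|/negbT vs]; rewrite ?eqxx // => /cK/andP[vK].
rewrite cardsU1 vs add1n eqSS => /eqP sp.
have gs : [set g x | x in s] = [set f x | x in s].
  by apply: eq_in_imset => x xs; rewrite fg //; apply: contraNneq vs => <-.
(* A simplex of the filling is the union of the two images of a simplex of [K], which is where
   contiguity enters. *)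
have tE : t = [set f x | x in v |: s] :|: [set g x | x in v |: s].
  apply/setP=> x; rewrite !imsetU1 gs fs !inE.
  case: (eqVneq x (f v)) => [->|_] //=; case: (eqVneq x (g v)) => [->|_] //=.
    by move: gt; rewrite !inE => /andP[].
  by rewrite orbb.
rewrite {1}tE KL //= -sp st.
rewrite (cardsD1 (f v) t) ft (cardsD1 (g v) (t :\ f v)).
by rewrite gt.
Qed.

Lemma boundariesD_trans K p c1 c2 c3 :
  c1 - c2 \in boundaries K p -> c2 - c3 \in boundaries K p ->
  c1 - c3 \in boundaries K p.
Proof. by move=> h1 h2; rewrite -(subrK c2 c1) -addrA rpredD. Qed.

Lemma contiguous_push f g K L p c :
  (forall s t : {set T}, s \in L -> t \subset s -> t != set0 -> t \in L) ->
  (forall s, s \in K -> [set f x | x in s] :|: [set g x | x in s] \in L) ->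
  set0 \notin K -> c \in cycles K p -> push f c - push g c \in boundaries L p.
Proof.
move=> Lsub KL K0 cK.
(* f is changed into g at the vertices of s only. *)
pose h (s : seq T) x := if x \in s then g x else f x.
suff H s : push f c - push (h s) c \in boundaries L p.
  rewrite -(@eq_push (h (enum T)) g) // => s _ x _.
  by rewrite /h mem_enum.
elim: s => [|v s IH].
  by rewrite subrr mem0v.
apply: boundariesD_trans IH _; apply: (@contiguous_one_vertex _ _ v K) cK => [u uv|t tK].
  by rewrite /h inE (negPf uv).
(* The images of [t] under two consecutive stages lie in the union of its images under [f] and
   [g]. *)
apply: Lsub (KL _ tK) _ _; last first.
  have /set0Pn[x xt] : t != set0 by apply: contraNneq K0 => <-.
  by apply/set0Pn; exists (h s x); rewrite inE imset_f.
apply/subsetP=> y; rewrite !inE => /orP[] /imsetP[x xt ->]; rewrite /h;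
  by case: ifP => _; rewrite imset_f ?orbT.
Qed.

End Contiguity.

(** * Barcodes: existence *)

Section Decomposition.
Variables (F : fieldType) (A : vectType F) (N : nat).
Variable f : nat -> 'End(A).

Lemma exists_functional (y : A) : y != 0 -> exists xi : 'Hom(A, F^o), xi y = 1.
Proof.
move=> y0; pose b := vbasis {:A}.
have /existsP[j nj] : [exists j, coord b j y != 0].
  apply: contraR y0 => /existsPn h; rewrite (coord_vbasis (memvf y)) big1 // => i _.
  by move: (h i); rewrite negbK => /eqP ->; rewrite scale0r.
exists ((coord b j y)^-1 *: linfun (coord b j : A -> F^o)).
by rewrite scale_lfunE lfunE /= /GRing.scale /= mulVf.
Qed.

(** An interval decomposition of the spaces [U k]: [c k] identifies [U k] with the functions
    supported on the indices active at [k]. The target does not depend on [k], so no transport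
    between terms is needed. *)
Definition subspace_coordinates (U : nat -> {vspace A}) (I : finType)
    (act : I -> nat -> bool) (c : nat -> 'Hom(A, {ffun I -> F^o})) : Prop :=
  forall k, (k <= N)%N ->
  [/\ forall v, v \in U k -> c k v = 0 -> v = 0,
      forall v i, v \in U k -> c k v i != 0 -> act i k,
      forall u : {ffun I -> F^o}, (forall i, u i != 0 -> act i k) ->
        exists2 v, v \in U k & c k v = u
    & forall v i, (k < N)%N -> v \in U k ->
        c k.+1 (f k v) i = if act i k.+1 then c k v i else 0].


Fixpoint iter_lfun b n : 'End(A) :=
  if n is n'.+1 then (f (b + n') \o iter_lfun b n')%VF else \1%VF.

(** For [n <= e], the functional [xi] precomposed with the maps from index [e - n] to index [e]. *)
Fixpoint pullback (xi : 'Hom(A, F^o)) e n : 'Hom(A, F^o) :=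
  if n is n'.+1 then (pullback xi e n' \o f (e - n))%VF else xi.

(* Splits off one interval summand: with b minimal such that U b is nonzero and
   e maximal such that U b has nonzero image in U e, the summand is spanned by
   the images of a vector of U b that survives until e, and its complement is
   the kernel of a functional on U e pulled back along f. *)
Lemma subspace_decomposition (U : nat -> {vspace A}) :
  (forall k, (k < N)%N -> (f k @: U k <= U k.+1)%VS) ->
  exists (I : finType) (bars : I -> nat * nat)
         (c : nat -> 'Hom(A, {ffun I -> F^o})),
    (forall i, ((bars i).1 <= (bars i).2 <= N)%N) /\
    subspace_coordinates U (fun i k => ((bars i).1 <= k <= (bars i).2)%N) c.
Proof.
have [n] := ubnP (\sum_(k < N.+1) \dim (U k)).
elim: n U => // n IH U dimU fU.
case: (pickP (fun k : 'I_N.+1 => U k != 0%VS)) => [k0 Uk0|U0]; last first.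
  exists void, (fun=> (0, 0)%N), (fun=> 0); split=> [[]//|k kN].
  have Uk : U k = 0%VS by have := U0 (Ordinal (kN : (k < N.+1)%N)); case: eqP.
  split=> [v|v []|u _|v []] //; first by rewrite Uk memv0 => /eqP.
  by exists 0; [exact: mem0v|apply/ffunP=> -[]].
have exb : exists b, (b <= N)%N && (U b != 0%VS).
  by exists k0; rewrite -ltnS ltn_ord.
have [b /andP[bN Ub] bmin] := ex_minnP exb.
have Ulow k : (k < b)%N -> U k = 0%VS.
  move=> kb; apply/eqP/negPn/negP => Uk; have := bmin k.
  by rewrite Uk (leq_trans (ltnW kb) bN) leqNgt kb => /(_ isT).
have exn : exists n, (b + n <= N)%N && (iter_lfun b n @: U b != 0)%VS.
  by exists 0%N; rewrite addn0 bN lim1g.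
have ubn j : (b + j <= N)%N && (iter_lfun b j @: U b != 0)%VS -> (j <= N)%N.
  by case/andP=> bj _; apply: leq_trans bj; apply: leq_addl.
have [l /andP[blN Ul] lmax] := ex_maxnP exn ubn.
pose e := (b + l)%N.
have be : (b <= e)%N by exact: leq_addr.
have /memv_imgP[x xU yE] := memv_pick (iter_lfun b l @: U b)%VS.
have [xi xiy] : exists xi : 'Hom(A, F^o), xi (iter_lfun b l x) = 1.
  by apply: exists_functional; rewrite -yE vpick0.
(* The image of [x] at index [k], spanning the new summand for [b <= k <= e]; below [b] the
   truncated subtraction gives the dummy value [x]. *)
pose xs k := iter_lfun b (k - b) x.
have xsS k : (b <= k)%N -> f k (xs k) = xs k.+1.
  by move=> bk; rewrite /xs subSn //= comp_lfunE subnKC.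
have xsU k : (b <= k <= N)%N -> xs k \in U k.
  elim: k => [|k IHk] /andP[].
    by rewrite leqn0 => /eqP b0 _; rewrite /xs b0 /= id_lfunE -b0.
  rewrite leq_eqVlt ltnS => /orP[/eqP <- _|bk kN].
    by rewrite /xs subnn id_lfunE.
  rewrite -xsS //; apply: (subvP (fU k kN)); apply: memv_img.
  by rewrite IHk // bk ltnW.
pose xik k := pullback xi e (e - k).
have xikS k v : (k < e)%N -> xik k.+1 (f k v) = xik k v.
  move=> ke; rewrite /xik -(subnSK ke) /= comp_lfunE subnSK //.
  by rewrite subKn // ltnW.
have xs1 k : (b <= k <= e)%N -> xik k (xs k) = 1.
  move=> /andP[bk ke]; rewrite -(subKn ke); have : (e - k <= l)%N.
    by rewrite leq_subLR /e leq_add2r.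
  elim: (e - k)%N => [|j IHj] jl.
    by rewrite subn0 /xik subnn /= /xs /e addKn.
  have je : (e - j.+1 < e)%N.
    rewrite ltn_subrL /=.
    exact: leq_trans (leq_trans (ltn0Sn j) jl) (leq_addl _ _).
  rewrite -xikS // xsS; last by rewrite /e -addnBA // leq_addr.
  have -> : ((e - j.+1).+1 = e - j)%N.
    by rewrite subnSK //; apply: leq_trans jl _; apply: leq_addl.
  exact/IHj/ltnW.
(* By maximality of [l], all of [U b] dies one step after [e]. *)
have xsend : (e < N)%N -> f e (xs e) = 0.
  move=> eN; apply/eqP; rewrite xsS // -memv0.
  suff /eqP <- : (iter_lfun b l.+1 @: U b == 0)%VS.
    by rewrite /xs /e -addnS addKn memv_img.
  apply/negPn/negP => h; have := lmax l.+1; rewrite h addnS eN.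
  by move/(_ isT); rewrite ltnn.
pose W k := if (b <= k <= e)%N then (U k :&: lker (xik k))%VS else U k.
have WU k : (W k <= U k)%VS by rewrite /W; case: ifP => _; rewrite ?capvSl.
(* The coordinate along the new bar; [v - zeta k v *: xs k] projects [U k] onto the complement
   [W k]. *)
pose zeta k := if (b <= k <= e)%N then xik k else 0.
have W_cut k v : (k <= N)%N -> v \in U k -> v - zeta k v *: xs k \in W k.
  move=> kN vU; rewrite /W /zeta; case: ifP => bke; last first.
    by rewrite lfunE /= scale0r subr0.
  have /andP[bk ke] := bke.
  rewrite memv_cap rpredB ?rpredZ ?xsU ?bk //= memv_ker linearB linearZ /= xs1 //.
  by rewrite /GRing.scale /= mulr1 subrr.
(* Inside the bar the functionals are compatible with [f]; the bar is entered from a zero space, and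
   past [e] the complement is everything. *)
have fW k : (k < N)%N -> (f k @: W k <= W k.+1)%VS.
  move=> kN; apply/subvP=> _ /memv_imgP[v vW ->].
  have fvU : f k v \in U k.+1.
    by apply: (subvP (fU k kN)); apply: memv_img; apply: (subvP (WU k)).
  rewrite {1}/W; case: ifP => // /andP[bk ke]; rewrite memv_cap fvU /= memv_ker.
  rewrite xikS //; move: vW; rewrite /W (ltnW ke) andbT.
  case: ifP => bk'; first by rewrite memv_cap memv_ker => /andP[].
  by rewrite Ulow ?memv0 => [/eqP ->|]; rewrite ?linear0 // ltnNge bk'.
have zetaS k v : (k < N)%N -> v \in U k ->
    f k v - zeta k.+1 (f k v) *: xs k.+1 = f k (v - zeta k v *: xs k).
  move=> kN vU; have [kb|bk] := ltnP k b.
    move: vU; rewrite Ulow // memv0 => /eqP ->.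
    by rewrite !linear0 !scale0r !subr0 linear0.
  rewrite [in RHS]linearB [in RHS]linearZ /= xsS // /zeta bk (leqW bk) /=.
  have [ke|ke|ke] := ltngtP k e; first by rewrite xikS.
    by rewrite !lfunE /= !scale0r.
  by rewrite -xsS // ke xsend -?ke // !scaler0.
have dimW : (\sum_(k < N.+1) \dim (W k) < n)%N.
  rewrite -ltnS; apply: leq_ltn_trans _ dimU.
  pose bo := Ordinal (bN : (b < N.+1)%N).
  rewrite (bigD1 bo) //= [in X in (_ <= X)%N](bigD1 bo) //= -addSn.
  apply: leq_add; last by apply: leq_sum => k _; apply/dimvS/WU.
  (* The dimension drops at [b]: otherwise [xs b] would lie in [W b], although the functional takes
     the value 1 on it. *)
  rewrite ltnNge; apply: contraT; rewrite negbK => dUW.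
  have := eqEdim (W b) (U b); rewrite WU dUW => /eqP WUb.
  have := xsU b; rewrite leqnn bN => /(_ isT); rewrite -WUb /W leqnn be.
  rewrite memv_cap memv_ker xs1 ?leqnn ?be // => /andP[_].
  by rewrite oner_eq0.
have [I [bars [c [barsN cP]]]] := IH W dimW fW.
(* [None] indexes the new bar, [Some i] the bars of the complement. *)
pose c'fun k (v : A) : {ffun option I -> F^o} :=
  [ffun o => if o is Some i then c k (v - zeta k v *: xs k) i else zeta k v].
have c'lin k : linear (c'fun k).
  move=> a u v; apply/ffunP=> -[i|]; rewrite !ffunE; last by rewrite linearP.
  have -> : a *: u + v - zeta k (a *: u + v) *: xs k =
      a *: (u - zeta k u *: xs k) + (v - zeta k v *: xs k).
    rewrite linearP scalerDl scalerBr scalerA addrACA opprD.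
    by [].
  by rewrite linearP !ffunE.
pose c' k := linfun (HB.pack_for {linear A -> {ffun option I -> F^o}} (c'fun k)
  (GRing.isLinear.Build F A {ffun option I -> F^o} _ _ (c'lin k))).
have c'E k v o : c' k v o =
    if o is Some i then c k (v - zeta k v *: xs k) i else zeta k v.
  by rewrite lfunE /= ffunE.
exists (option I), (fun o => if o is Some i then bars i else (b, e)), c'.
split=> [[i|] //=|k kN]; first by rewrite be.
have [cinj csupp csurj ccomm] := cP k kN; split.
- move=> v vU c'v0; have z0 : zeta k v = 0 by rewrite -(c'E k v None) c'v0 ffunE.
  apply: cinj; first by have := W_cut k v kN vU; rewrite z0 scale0r subr0.
  apply/ffunP=> i; have := c'E k v (Some i); rewrite c'v0 !ffunE z0 scale0r subr0.
  by move=> <-.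
- move=> v [i|] vU; rewrite c'E; first exact/csupp/W_cut.
  by rewrite /zeta; case: ifP => //=; rewrite lfunE eqxx.
- move=> u uact; have [|w wW cw] := csurj [ffun i => u (Some i)].
    by move=> i; rewrite ffunE => /uact.
  have zw : zeta k w = 0.
    rewrite /zeta; case: ifP => h; last by rewrite lfunE.
    by move: wW; rewrite /W h memv_cap memv_ker => /andP[_ /eqP].
  have zx : zeta k (u None *: xs k) = u None.
    rewrite linearZ /zeta /=; case: ifP => h.
      by rewrite xs1 // /GRing.scale /= mulr1.
    rewrite lfunE /= scaler0; apply/esym/eqP/negPn/negP => /uact /=.
    by rewrite h.
  exists (w + u None *: xs k).
    apply: rpredD; first exact: (subvP (WU k)).
    case: (eqVneq (u None) 0) => [->|/uact /=].
      by rewrite scale0r mem0v.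
    by move=> /andP[bk _]; apply: rpredZ; apply: xsU; rewrite bk.
  apply/ffunP=> o; rewrite c'E.
  have -> : zeta k (w + u None *: xs k) = u None by rewrite linearD /= zw zx add0r.
  case: o => // i.
  by rewrite addrK cw ffunE.
move=> v [i|] kN' vU; rewrite !c'E.
  by rewrite zetaS // ccomm // W_cut.
rewrite /zeta; case: ifP => bk1; last by rewrite lfunE.
case: ifP => [/andP[bk ke]|bk].
  by rewrite xikS //; case/andP: bk1.
suff kb : (k < b)%N.
  move: vU; rewrite Ulow // memv0 => /eqP ->.
  by rewrite [f k 0]linear0 [LHS]linear0 lfunE.
by rewrite ltnNge; apply: contraFN bk => ->; case/andP: bk1 => _ /ltnW.
Qed.


End Decomposition.

(* An isomorphism with the sum of the interval modules [act i], i : I, given by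
   coordinates in a space that does not depend on k. *)
Definition pm_coordinates (F : fieldType) N (M : pmodule F) (I : finType)
    (act : I -> nat -> bool) : Prop :=
  exists c : forall k, {linear pm_space M k -> {ffun I -> F^o}},
  forall k, (k <= N)%N ->
  [/\ forall x, c k x = 0 -> x = 0,
      forall x i, c k x i != 0 -> act i k,
      forall u : {ffun I -> F^o}, (forall i, u i != 0 -> act i k) ->
        exists x, c k x = u
    & forall x i, (k < N)%N ->
        c k.+1 (pm_map M k x) i = if act i k.+1 then c k x i else 0].

(** * From coordinates to barcodes, and passage to every second term *)

Lemma inj_surj_bijective (A B : choiceType) (h : A -> B) :
  injective h -> (forall y, exists x, h x = y) -> bijective h.
Proof.
move=> hinj hsurj; have ex y : exists x, h x == y.
  by have [x <-] := hsurj y; exists x.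
exists (fun y => xchoose (ex y)) => [x|y]; last exact/eqP/(xchooseP (ex y)).
exact/hinj/eqP/(xchooseP (ex (h x))).
Qed.

(** Multiplicities are kept: positions of [D] correspond one to one to indices in [P], even when [x]
    takes equal values. *)
Lemma perm_map_enum_index (I : finType) (A : eqType) (P : pred I) (x : I -> A) x0 D :
  perm_eq D [seq x i | i <- enum P] ->
  exists f : 'I_(size D) -> I,
    [/\ injective f, forall j, P (f j), forall i, P i -> exists j, f j = i
      & forall j : 'I_(size D), nth x0 D j = x (f j)].
Proof.
case/(perm_iotaP x0) => Is; rewrite size_map => Isp DE.
have sD : size Is = size D by rewrite DE size_map.
have IsP (j : 'I_(size D)) : (nth 0%N Is j < size (enum P))%N.
  have : nth 0%N Is j \in Is by rewrite mem_nth ?sD.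
  by rewrite (perm_mem Isp) mem_iota.
pose f (j : 'I_(size D)) := tnth (in_tuple (enum P)) (Ordinal (IsP j)).
exists f; split.
- move=> j j' /eqP; rewrite /f !(tnth_nth (f j)) /= nth_uniq ?enum_uniq ?IsP //.
  by rewrite nth_uniq ?(perm_uniq Isp) ?iota_uniq ?sD // => /eqP/val_inj.
- by move=> j; have := mem_tnth (Ordinal (IsP j)) (in_tuple (enum P)); rewrite mem_enum.
- move=> i Pi; have iP : i \in enum P by rewrite mem_enum.
  have : index i (enum P) \in Is by rewrite (perm_mem Isp) mem_iota index_mem.
  move/(nthP 0%N) => [j]; rewrite sD => jD jE; exists (Ordinal jD).
  by rewrite /f (tnth_nth i) /= jE nth_index.
move=> j; rewrite [nth _ _ _](congr1 (fun D' => nth x0 D' j) DE).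
rewrite (nth_map 0%N) ?sD // (nth_map (f j)) ?IsP //.
by rewrite [in RHS]/f (tnth_nth (f j)).
Qed.

(** [P] singles out the indices active at some [k <= N]; the others contribute no bar. The
    isomorphism restricts the coordinates at [k] to the bars active there. *)
Lemma pm_coordinates_barcode (F : fieldType) N (M : pmodule F) (I : finType)
    (act : I -> nat -> bool) (P : pred I) (bars : I -> nat * nat) :
  (forall i k, (k <= N)%N -> act i k = P i && ((bars i).1 <= k <= (bars i).2)%N) ->
  (forall i, P i -> ((bars i).1 <= (bars i).2 <= N)%N) ->
  pm_coordinates N M act -> is_barcode N M [seq bars i | i <- enum P].
Proof.
move=> actE barsN [c cP]; set s := [seq bars i | i <- enum P].
split=> [be /mapP[i iP ->]|]; first by apply: barsN; rewrite mem_enum in iP.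
have [idx [idx_inj idxP idx_surj idxE]] := perm_map_enum_index (0, 0)%N (perm_refl s).
have activeE k (j : 'I_(size s)) : (k <= N)%N -> bar_active k j = act (idx j) k.
  move=> kN; rewrite actE // idxP /= /bar_active.
  by rewrite idxE.
pose J k := {j : 'I_(size s) | bar_active k j}.
pose phi k (x : pm_space M k) : interval_space F s k :=
  [ffun j : J k => c k x (idx (val j))].
have phi_lin k : linear (phi k).
  by move=> a u v; apply/ffunP=> j; rewrite !ffunE linearP !ffunE.
exists (fun k => HB.pack_for {linear pm_space M k -> interval_space F s k} (phi k)
  (GRing.isLinear.Build F _ _ _ _ (phi_lin k))); split=> k kN.
  have [cinj csupp csurj _] := cP k kN.
  apply: inj_surj_bijective => /= [x y xy|v].
    apply/eqP; rewrite -subr_eq0; apply/eqP/cinj/ffunP=> i; rewrite ffunE.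
    apply/eqP/negPn/negP => nz; have ai := csupp _ _ nz.
    have [j ji] : exists j, idx j = i.
      by apply: idx_surj; move: ai; rewrite actE // => /andP[].
    have aj : bar_active k j by rewrite activeE // ji.
    move/ffunP/(_ (Sub j aj)): xy; rewrite !ffunE SubK ji => xy.
    by move: nz; rewrite linearB !ffunE xy subrr eqxx.
  pose u : {ffun I -> F^o} :=
    [ffun i => if [pick j : J k | idx (val j) == i] is Some j then v j else 0].
  have [|x xu] := csurj u.
    move=> i; rewrite ffunE; case: pickP => [j /eqP <- _|]; last by rewrite eqxx.
    by rewrite -activeE // (valP j).
  exists x; apply/ffunP=> j; rewrite ffunE xu ffunE.
  case: pickP => [j' /eqP /idx_inj /val_inj -> //|/(_ j)].
  by rewrite eqxx.
move=> x /=; apply/ffunP=> j; rewrite !ffunE.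
have [_ csupp _ ->] := cP k (ltnW kN) => //.
rewrite -activeE // (valP j); case: insubP => [i _ ij|]; first by rewrite ffunE ij.
rewrite activeE ?(ltnW kN) // => na; apply/eqP/negPn/negP => /csupp.
exact/negP.
Qed.

(** Bars are intervals, so one that is active at [k.*2 + o] and two steps later is active in between
    and survives the composite of the two maps. *)
Lemma pm_coordinates_sample (F : fieldType) N N' o (M : pmodule F) (I : finType)
    (bars : I -> nat * nat)
    (g : forall k, {linear pm_space M (k.*2 + o) -> pm_space M (k.+1.*2 + o)}) :
  (N.*2 + o <= N')%N ->
  (forall k x, (k < N)%N -> g k x = pm_map M (k.*2 + o).+1 (pm_map M (k.*2 + o) x)) ->
  pm_coordinates N' M (fun i k => ((bars i).1 <= k <= (bars i).2)%N) ->
  pm_coordinates N (@PModule F (fun k => pm_space M (k.*2 + o)) g)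
    (fun i k => ((bars i).1 <= k.*2 + o <= (bars i).2)%N).
Proof.
move=> NN' gE [c cP]; exists (fun k => c (k.*2 + o)%N) => k kN.
have kN' : (k.*2 + o <= N')%N by apply: leq_trans NN'; rewrite leq_add2r leq_double.
have [cinj csupp csurj ccomm] := cP _ kN'.
split; [exact: cinj|exact: csupp|exact: csurj|move=> x i kN1 /=].
have kN2 : ((k.*2 + o).+2 <= N')%N.
  by apply: leq_trans NN'; rewrite -!addSn leq_add2r -doubleS leq_double.
have [_ csupp1 _ ccomm1] := cP _ (ltnW kN2).
rewrite gE // -[(k.+1.*2 + o)%N]/((k.*2 + o).+2) ccomm1 // (ccomm _ _ (ltnW kN2)).
case: ifP => // /andP[b2 e2]; case: ifP => // /negP h.
apply/esym/eqP/negPn/negP => /csupp /andP[b0 e0]; apply: h.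
by rewrite (leq_trans b0 (leqnSn _)) (leq_trans (leqnSn _) e2).
Qed.

(** * Interval decomposition of the homology of a sequence of complexes *)

Section HomologyDecomposition.
Variable T : finType.
Implicit Types (K L : {set {set T}}) (f : T -> T) (p : nat).

(** A projection with kernel [boundaries K p]. It gives each homology class a canonical
    representative, so that all homology groups become subspaces of the single space [chain T]. *)
Definition boundary_complement K p : 'End(chain T) :=
  (\1 - projv (boundaries K p))%VF.

Lemma boundary_complement_eq0 K p c :
  (boundary_complement K p c == 0) = (c \in boundaries K p).
Proof.
rewrite /boundary_complement add_lfunE opp_lfunE id_lfunE subr_eq0 eq_sym.
by apply/eqP/idP => [<-|/projv_id //]; apply: memv_proj.
Qed.

Definition reduced_cycle K p (h : homology K p) : chain T :=
  boundary_complement K p (vsval (of_quotv h)).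

Lemma reduced_cycleE K p (z : subvs_of (cycles K p)) :
  reduced_cycle (to_quotv (boundaries K p) z : homology K p) =
  boundary_complement K p (vsval z).
Proof.
apply/eqP; rewrite -subr_eq0 -linearB boundary_complement_eq0 -to_quotv_eq.
by rewrite of_quotvK.
Qed.

Lemma reduced_cycle_linear K p : linear (@reduced_cycle K p).
Proof.
move=> a u v; rewrite -[u]of_quotvK -[v]of_quotvK.
rewrite -[a *: to_quotv _ _]/(quotv_scale a _) to_quotvZ -to_quotvD.
by rewrite !reduced_cycleE !linearP.
Qed.
HB.instance Definition _ K p :=
  GRing.isLinear.Build 'F_2 (homology K p) (chain T) _
    (@reduced_cycle K p) (@reduced_cycle_linear K p).

Lemma homology_coordinates (X : nat -> {set {set T}}) (f : nat -> T -> T) N p :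
  (forall k, (k < N)%N -> simplicial (f k) (X k) (X k.+1)) ->
  exists (I : finType) (bars : I -> nat * nat),
    (forall i, ((bars i).1 <= (bars i).2 <= N)%N) /\
    pm_coordinates N (homology_pmodule X f p)
      (fun i k => ((bars i).1 <= k <= (bars i).2)%N).
Proof.
move=> fX.
pose U k := (boundary_complement (X k) p @: cycles (X k) p)%VS.
(* The induced map on canonical representatives: push, then reduce again. *)
pose g k := (boundary_complement (X k.+1) p \o push (f k))%VF.
have gE k c : (k < N)%N -> g k (boundary_complement (X k) p c) =
    boundary_complement (X k.+1) p (push (f k) c).
  move=> kN; rewrite /g comp_lfunE; apply/eqP; rewrite -subr_eq0 -!linearB.
  rewrite boundary_complement_eq0; apply: (push_boundaries (fX k kN)).
  rewrite /boundary_complement add_lfunE opp_lfunE id_lfunE addrAC subrr add0r.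
  by rewrite rpredN memv_proj.
have gU k : (k < N)%N -> (g k @: U k <= U k.+1)%VS.
  move=> kN; apply/subvP=> _ /memv_imgP[_ /memv_imgP[z zZ ->] ->].
  by rewrite gE // memv_img // (push_cycles (fX k kN)).
have [I [bars [c [barsN cP]]]] := subspace_decomposition gU.
exists I, bars; split=> //.
pose q k (h : homology (X k) p) := c k (reduced_cycle h).
have q_lin k : linear (q k) by move=> a u v; rewrite /q !linearP.
exists (fun k => HB.pack_for {linear homology (X k) p -> {ffun I -> ('F_2)^o}} (q k)
  (GRing.isLinear.Build 'F_2 _ _ _ _ (q_lin k))) => k kN /=.
have rU (h : homology (X k) p) : reduced_cycle h \in U k.
  by apply/memv_img/subvsP.
have [cinj csupp csurj ccomm] := cP k kN; split.
- move=> h /(cinj _ (rU h))/eqP; rewrite boundary_complement_eq0 => hB.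
  have q0 : to_quotv (boundaries (X k) p) (0 : subvs_of (cycles (X k) p)) = 0.
    by apply: (addrI (to_quotv _ 0)); rewrite -to_quotvD !addr0.
  by apply/eqP; rewrite -[h]of_quotvK -q0 to_quotv_eq [vsval 0]linear0 subr0.
- by move=> h i; apply: csupp.
- move=> u /csurj[_ /memv_imgP[z zZ ->] cz].
  exists (to_quotv (boundaries (X k) p) (vsproj (cycles (X k) p) z)).
  by rewrite /q reduced_cycleE vsprojK.
move=> h i kN'; rewrite /q -ccomm //; congr (c k.+1 _ i).
rewrite -{1}[h]of_quotvK hmap_funE ?fX // reduced_cycleE vsprojK; last first.
  exact/(push_cycles (fX k kN'))/subvsP.
by rewrite -gE.
Qed.

End HomologyDecomposition.

(** * Barcodes: uniqueness *)

Section Uniqueness.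
Variable F : fieldType.

Lemma leq_card_linear (A B : finType)
    (h : {linear {ffun A -> F^o} -> {ffun B -> F^o}}) :
  (forall u, h u = 0 -> u = 0) -> (#|A| <= #|B|)%N.
Proof.
move=> h0; have := limg_ker_dim (linfun h) fullv.
have -> : (fullv :&: lker (linfun h) = 0)%VS.
  apply/eqP; rewrite -subv0; apply/subvP=> v; rewrite memv_cap memv_ker memv0.
  by rewrite lfunE /= => /andP[_ /eqP/h0 ->].
rewrite dimv0 add0n => /esym dA.
have := dimvS (subvf (linfun h @: fullv)%VS); rewrite -dA !dimvf.
by rewrite -[dim _]/(#|A| * 1)%N -[dim _]/(#|B| * 1)%N !muln1.
Qed.

(** Extension by 0 followed by restriction to [Q]. The maps of an interval sum are of this kind. *)
Definition transfer (T : finType) (P Q : pred T)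
    (u : {ffun {x | P x} -> F^o}) : {ffun {x | Q x} -> F^o} :=
  [ffun x => if insub (val x) is Some t then u t else 0].
Arguments transfer {T} P Q u.

Lemma transfer_is_linear (T : finType) (P Q : pred T) : linear (transfer P Q).
Proof.
move=> a u v; apply/ffunP=> x; rewrite !ffunE.
by case: insubP => [t _ _|_]; rewrite ?ffunE ?scaler0 ?addr0.
Qed.
HB.instance Definition _ (T : finType) (P Q : pred T) :=
  GRing.isLinear.Build F {ffun {x | P x} -> F^o} {ffun {x | Q x} -> F^o} _
    (transfer P Q) (@transfer_is_linear T P Q).

Lemma transfer_comp (T : finType) (P Q S : pred T) u :
  (forall x, P x -> S x -> Q x) ->
  transfer Q S (transfer P Q u) = transfer P S u.
Proof.
move=> PSQ; apply/ffunP=> x; rewrite !ffunE.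
case: insubP => [y _ yx|nQ]; first by rewrite ffunE yx.
by case: insubP => // z Pz _; rewrite PSQ ?(valP x) in nQ.
Qed.

Lemma transfer_id (T : finType) (P : pred T) u : transfer P P u = u.
Proof. by apply/ffunP=> x; rewrite ffunE valK. Qed.

Fixpoint pm_iter (M : pmodule F) i n : pm_space M i -> pm_space M (n + i) :=
  if n is n'.+1 then fun x => pm_map M (n' + i) (pm_iter n' x) else id.

Lemma pm_iter_interval_sum (s : seq (nat * nat)) i n (u : interval_space F s i) :
  pm_iter (M := interval_sum F s) n u =
  transfer (@bar_active s i) (@bar_active s (n + i)) u.
Proof.
elim: n => [|n IH] /=; first by rewrite [RHS]transfer_id.
rewrite IH; apply: transfer_comp => j /andP[b1 e1] /andP[b2 e2].
apply/andP; split; first exact: leq_trans b1 (leq_addl _ _).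
exact: leq_trans (leqnSn _) e2.
Qed.

(** For [i <= j], the number of such bars is the rank of the map from index [i] to index [j]. *)
Definition through i j (be : nat * nat) := (be.1 <= i)%N && (j <= be.2)%N.

Lemma count_nth_ord (T : Type) x0 (s : seq T) (a : pred T) :
  #|[pred j : 'I_(size s) | a (nth x0 s j)]| = count a s.
Proof. by rewrite -sum1_card -sum1_count (big_nth x0) big_mkord. Qed.

(** A rank comparison: combinations of the bars of [s] that reach [n + i] embed, by way of [M], into
    the coordinates on the bars of [s'] that reach [n + i]. *)
Lemma barcode_count_through N (M : pmodule F) s s' i n :
  is_barcode N M s -> is_barcode N M s' -> (n + i <= N)%N ->
  (count (through i (n + i)) s <= count (through i (n + i)) s')%N.
Proof.
move=> [_ [phi [phib phiC]]] [_ [psi [psib psiC]]] niN.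
have iN : (i <= N)%N by apply: leq_trans niN; apply: leq_addl.
have iterC (M' : pmodule F) (h : forall k, {linear pm_space M k -> pm_space M' k}) :
    (forall k, (k < N)%N -> forall x, h k.+1 (pm_map M k x) = pm_map M' k (h k x)) ->
    forall m x, (m + i <= N)%N -> h (m + i)%N (pm_iter m x) = pm_iter m (h i x).
  by move=> hC; elim=> [|m IH] x miN //=; rewrite hC // IH // ltnW.
rewrite -!(count_nth_ord (0, 0)%N).
pose thr (s : seq (nat * nat)) :=
  [pred j : 'I_(size s) | through i (n + i) (nth (0, 0)%N s j)].
have := phib _ iN; set phi_i := phi i => -[phi' phiK phi'K].
have phi'lin : linear phi'.
  by move=> a u v; apply: (can_inj phiK); rewrite linearP !phi'K.
pose phi'l := HB.pack_for {linear interval_space F s i -> pm_space M i} phi'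
  (GRing.isLinear.Build F _ _ _ _ phi'lin).
pose h u := transfer (@bar_active s' i) (thr s')
  (psi i (phi'l (transfer (thr s) (@bar_active s i) u))).
have hlin : linear h by move=> a u v; rewrite /h !linearP.
suff : (#|{: {j | thr s j}}| <= #|{: {j | thr s' j}}|)%N by rewrite !card_sig.
apply: (@leq_card_linear _ _ (HB.pack_for
  {linear {ffun {j | thr s j} -> F^o} -> {ffun {j | thr s' j} -> F^o}} h
  (GRing.isLinear.Build F _ _ _ _ hlin))) => u /= hu.
pose x := phi'l (transfer (thr s) (@bar_active s i) u).
(* At index [n + i] only the coordinates of [s'] in [thr s'] are left, and these vanish. *)
have x0 : pm_iter n x = 0.
  have [psi' psiK _] := psib _ niN; apply: (can_inj psiK).
  rewrite iterC // linear0 pm_iter_interval_sum.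
  rewrite -(@transfer_comp _ _ (thr s')); last first.
    by move=> j /andP[b1 _] /andP[_ e2]; apply/andP.
  by rewrite [transfer _ (thr s') _]hu linear0.
(* Read in [s], the vector [x] is carried to [n + i] with its coordinates unchanged, so [u] is 0. *)
have := iterC _ phi phiC n x niN.
rewrite x0 linear0 /x [phi i _]phi'K pm_iter_interval_sum.
have thr_active k j : (i <= k <= n + i)%N -> thr s j -> bar_active k j.
  move=> /andP[ik kn] /andP[b1 e2]; rewrite /bar_active (leq_trans b1 ik).
  exact: leq_trans e2.
rewrite transfer_comp => [|j /thr_active h1 _]; last by rewrite h1 // leqnn leq_addl.
move/(congr1 (transfer _ (thr s))); rewrite linear0 transfer_comp ?transfer_id //.
by move=> j /thr_active h1 _; rewrite h1 // leqnn leq_addl.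
Qed.

(** The ranks determine multiplicities by two differences: bars starting at [b] and reaching [j] are
    those through [b, j] minus those through [b - 1, j]; bars ending exactly at [e] are those
    reaching [e] minus those reaching [e + 1]. *)
Lemma barcode_uniq N (M : pmodule F) s s' :
  is_barcode N M s -> is_barcode N M s' -> perm_eq s s'.
Proof.
move=> sM s'M.
have countE i j : (i <= j <= N)%N -> count (through i j) s = count (through i j) s'.
  case/andP=> ij jN; rewrite -(subnK ij); rewrite -(subnK ij) in jN.
  by apply/eqP; rewrite eqn_leq !(barcode_count_through (N := N) (M := M)).
pose born b j (be : nat * nat) := (be.1 == b) && (j <= be.2)%N.
have bornE t b j : count (through b j) t =
    (count (born b j) t + if b is b'.+1 then count (through b' j) t else 0)%N.
  elim: t => [|be t IH] /=; first by case: b.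
  rewrite IH /born /through; case: b {IH} => [|b] /=.
    by rewrite leqn0 !addn0.
  rewrite [(be.1 <= b.+1)%N]leq_eqVlt ltnS addnACA; congr (_ + _)%N.
  by case: eqP => [->|] //=; rewrite ltnn addn0.
have bornC b j : (b <= j <= N)%N -> count (born b j) s = count (born b j) s'.
  move=> /[dup] /countE; rewrite !bornE; case: b => [|b]; first by rewrite !addn0.
  by move=> e /andP[bj jN]; move: e; rewrite countE ?(ltnW bj) // => /addIn.
have exactE t b e : count (born b e) t = (count_mem (b, e) t + count (born b e.+1) t)%N.
  elim: t => //= -[b' e'] t ->; rewrite addnACA; congr (_ + _)%N; rewrite /born /=.
  rewrite [in LHS]leq_eqVlt -[_ == _ :> nat * nat]/((_ == _) && (_ == _)) /=.
  by case: (b' == b) => //=; rewrite eq_sym; case: eqP => [->|]; rewrite ?ltnn.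
have bornN t b e : is_barcode N M t -> (N <= e)%N -> count (born b e.+1) t = 0%N.
  move=> [tN _] Ne; apply/eqP; rewrite -leqn0 leqNgt -has_count; apply/hasPn => be /tN.
  move=> /andP[_ eN]; rewrite /born negb_and -ltnNge ltnS (leq_trans eN) ?orbT //.
apply/allP=> -[b e] /=; rewrite mem_cat => bet.
have /andP[be eN] : (b <= e <= N)%N.
  by case/orP: bet => [/(sM.1)|/(s'M.1)].
apply/eqP/(@addIn (count (born b e.+1) s)); rewrite -exactE bornC ?be // exactE.
congr (_ + _)%N; case: (ltnP e N) => eN'; last by rewrite !bornN.
by rewrite bornC // eN' ltnW.
Qed.

End Uniqueness.

From mathcomp Require Import zify lra ring.
From mathcomp Require Import all_classical all_reals all_analysis finmap.
Import Order.TTheory GRing.Theory Num.Theory.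
Local Open Scope ring_scope.

(** * Bottleneck matchings *)

Section Matching.
Variable R : realType.

(** Points with the same index are matched to each other, the remaining ones to the diagonal. *)
Lemma delta_matching_index (I : finType) (P P' : pred I) (x x' : I -> R * R)
    delta D D' :
  perm_eq D [seq x i | i <- enum P] -> perm_eq D' [seq x' i | i <- enum P'] ->
  (forall i, P i -> P' i -> linfty (x i) (x' i) <= delta) ->
  (forall i, P i -> ~~ P' i -> diagonal_dist (x i) <= delta) ->
  (forall i, P' i -> ~~ P i -> diagonal_dist (x' i) <= delta) ->
  delta_matching delta D D'.
Proof.
case/(perm_map_enum_index (0, 0)) => f [finj fP fsurj fE].
case/(perm_map_enum_index (0, 0)) => f' [f'inj f'P f'surj f'E] both left right.
exists (finset (fun ij => f ij.1 == f' ij.2)); split.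
- move=> [i j] [i' j']; rewrite !inE /= => /eqP e /eqP e' ii'; rewrite ii' in e *.
  by congr (_, _); apply: f'inj; rewrite -e -e'.
- move=> [i j] [i' j']; rewrite !inE /= => /eqP e /eqP e' jj'; rewrite jj' in e *.
  by congr (_, _); apply: finj; rewrite e e'.
- by move=> i j; rewrite inE /= fE f'E => /eqP e; rewrite -e both // e.
- move=> i ni; rewrite fE; apply: left => //; apply/negP => /f'surj[j e].
  by have := ni j; rewrite inE /= e eqxx.
move=> j nj; rewrite f'E; apply: right => //; apply/negP => /fsurj[i e].
by have := nj i; rewrite inE /= e eqxx.
Qed.

Lemma bottleneck_le delta (D D' : seq (R * R)) :
  0 <= delta -> delta_matching delta D D' -> bottleneck D D' <= delta.
Proof.
move=> d0 DD'; apply: ge_inf; last by split.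
by exists 0 => e [].
Qed.

Lemma ln_log_scale (alpha eps : R) k : 0 < alpha -> 0 <= eps ->
  ln (log_scale alpha eps k) = ln alpha + k%:R * ln (1 + eps).
Proof.
move=> a0 e0; have e1 : 0 < 1 + eps by rewrite ltr_pwDl.
by rewrite /log_scale lnM ?posrE ?exprn_gt0 // lnXn // mulr_natl.
Qed.

Definition log_point (alpha eps : R) (b e : nat) : R * R :=
  (ln (log_scale alpha eps b), ln (log_scale alpha eps e)).

Lemma linfty_log_point (alpha eps : R) b e b' e' : 0 < alpha -> 0 <= eps ->
  (b' <= b <= b'.+1)%N -> (e' <= e <= e'.+1)%N ->
  linfty (log_point alpha eps b e) (log_point alpha eps b' e') <= ln (1 + eps).
Proof.
move=> a0 e0; have L0 : 0 <= ln (1 + eps) by rewrite ln_ge0 // lerDl.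
have near i i' : (i' <= i <= i'.+1)%N ->
    `|ln (log_scale alpha eps i) - ln (log_scale alpha eps i')| <= ln (1 + eps).
  move=> ii'; rewrite !ln_log_scale // opprD addrACA subrr add0r -mulrBl.
  have -> : i%:R - i'%:R = (i - i')%:R :> R by rewrite natrB //; case/andP: ii'.
  rewrite normrM normr_nat ger0_norm // ler_piMl // lern1; lia.
by move=> bb' ee'; rewrite /linfty ge_max !near.
Qed.

Lemma diagonal_dist_log_point (alpha eps : R) b : 0 < alpha -> 0 <= eps ->
  diagonal_dist (log_point alpha eps b b.+1) <= ln (1 + eps).
Proof.
move=> a0 e0; have L0 : 0 <= ln (1 + eps) by rewrite ln_ge0 // lerDl.
rewrite /diagonal_dist /log_point /= !ln_log_scale // opprD addrACA subrr add0r.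
rewrite -mulrBl -natr1 addrAC subrr add0r mul1r ger0_norm //; lra.
Qed.

End Matching.

(** * Packing *)

(** A simplex with at most [p.+1] vertices is coded by one vertex [v] and a [p]-tuple from [nbr v]
    listing the others, padded with [v]. *)
Lemma card_skeleton_le (T : finType) (K : {set {set T}}) (nbr : T -> {set T}) p :
  (forall s, s \in K -> s != finset.set0 /\ forall v, v \in s -> s \subset nbr v) ->
  (#|skeleton p K| <= \sum_(v : T) #|nbr v| ^ p)%N.
Proof.
move=> Knbr.
pose E := finset (fun x : T * {ffun 'I_p -> T} => x.2 \in ffun_on (mem (nbr x.1))).
have -> : (\sum_(v : T) #|nbr v| ^ p = #|E|)%N.
  rewrite -sum1_card (eq_bigl (fun x : T * {ffun 'I_p -> T} =>
    true && (x.2 \in ffun_on (mem (nbr x.1))))); last by move=> x; rewrite inE.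
  rewrite -(pair_big_dep xpredT (fun v (g : {ffun 'I_p -> T}) =>
    g \in ffun_on (mem (nbr v))) (fun _ _ => 1%N)) /=.
  by apply: eq_bigr => v _; rewrite sum1_card card_ffun_on card_ord.
pose span (x : T * {ffun 'I_p -> T}) := x.1 |: [set x.2 i | i : 'I_p]%SET.
apply: leq_trans (leq_imset_card span (mem E)).
apply/subset_leq_card/fintype.subsetP => s.
rewrite inE => /andP[sK sp]; have [/set0Pn[v vs] /(_ v vs) snbr] := Knbr s sK.
pose t := enum (s :\ v)%SET.
have tp : (size t <= p)%N by move: sp; rewrite (cardsD1 v) vs -cardE.
have tP x : x \in t = (x != v) && (x \in s) by rewrite mem_enum !inE.
have ts (i : 'I_p) : nth v t i \in s.
  case: (ltnP i (size t)) => it; last by rewrite nth_default.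
  by have := mem_nth v it; rewrite tP => /andP[].
apply/imsetP; exists (v, [ffun i : 'I_p => nth v t i]).
  rewrite inE /=; apply/ffun_onP => i; rewrite ffunE.
  exact: (fintype.subsetP snbr).
apply/finset.setP => x; rewrite /span /= !inE; apply/idP/orP => [xs|[/eqP ->|]] //.
  case: (eqVneq x v) => xv; [by left|right].
  have xt : x \in t by rewrite tP xv.
  have ip : (index x t < p)%N by apply: leq_trans tp; rewrite index_mem.
  by apply/imsetP; exists (Ordinal ip); rewrite ?ffunE ?nth_index.
by case/imsetP => i _ ->; rewrite ffunE.
Qed.

Section Packing.
Variables (R : realType) (X : metricType R) (d : R).
Hypothesis cov : half_coverable X d.

Lemma iterated_cover j (x : X) (r : R) : 0 < r ->
  exists s : seq X, (size s)%:R <= (2 `^ d) ^+ j /\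
    forall z, ball x r z -> exists2 y, y \in s & ball y (r / 2 ^+ j) z.
Proof.
move=> r0; elim: j => [|j [s [ss scov]]].
  exists [:: x]; split=> // z xz; exists x; first by rewrite inE.
  by rewrite expr0 divr1.
have rj : 0 < r / 2 ^+ j by rewrite divr_gt0 // exprn_gt0.
have /choice[c cP] := fun y => cov y rj.
exists (flatten [seq c y | y <- s]); split.
  apply: (@le_trans _ _ ((size s)%:R * 2 `^ d)).
    elim: s {ss scov} => [|y s IH] /=; first by rewrite mul0r.
    rewrite size_cat natrD -add1n natrD mulrDl mul1r lerD //.
    by case: (cP y).
  by rewrite exprSr ler_wpM2r // powR_ge0.
move=> z /scov[y ys yz]; have [_ /(_ z yz)[y' y'c y'z]] := cP y.
exists y'; last by rewrite exprSr invfM mulrA.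
by apply/flattenP; exists (c y) => //; apply: map_f.
Qed.

(** After [j] halvings the covering balls have radius at most [delta / 2], so each contains at most
    one point of [S]. *)
Lemma packing_bound (V : {fset X}) (S : {set V}) (x : X) (r delta : R) j :
  0 < r -> r / 2 ^+ j <= delta / 2 ->
  (forall u, u \in S -> mdist x (val u) < r) ->
  (forall u v, u \in S -> v \in S -> u != v -> delta < pdist u v) ->
  #|S|%:R <= (2 `^ d) ^+ j.
Proof.
move=> r0 rj Sx Ssep; have [s [ss scov]] := iterated_cover j x r0.
apply: le_trans ss; rewrite ler_nat.
have /choice[c cP] : forall u : V, exists y : X,
    u \in S -> y \in s /\ mdist y (val u) < r / 2 ^+ j.
  move=> u; case: (boolP (u \in S)) => uS; last by exists (val u).
  have [|y ys yu] := scov (val u); first by rewrite ballEmdist; apply: Sx.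
  by exists y => _; split=> //; move: yu; rewrite ballEmdist.
rewrite cardE -(size_map c); apply: uniq_leq_size.
  rewrite map_inj_in_uniq ?enum_uniq // => u v.
  rewrite !mem_enum => uS vS cuv; apply/eqP; apply: contraT => /(Ssep u v uS vS).
  have [_ cu] := cP u uS; have [_ cv] := cP v vS; rewrite cuv in cu.
  have := metric_triangle (val u) (c v) (val v); rewrite (metric_sym (val u) (c v)).
  rewrite /pdist; move: cu cv rj.
  move: (mdist _ _) (mdist _ _) (mdist _ _) (r / _) => a b e h.
  lra.
by move=> _ /mapP[u uS ->]; rewrite mem_enum in uS; case: (cP u uS).
Qed.

End Packing.

(** Serves to round [1 / eps] up to a power of two, so that it becomes a whole number of
    halvings. *)
Lemma exists_dyadic_bracket (R : realType) (a : R) : 1 <= a ->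
  exists h : nat, a <= 2 ^+ h <= 2 * a.
Proof.
move=> a1; have exh : exists h, a <= 2 ^+ h.
  by exists (Num.bound a); apply/ltW/upper_nthrootP.
have [[|h] ah hmin] := ex_minnP exh; [exists 0%N|exists h.+1]; rewrite ah /=.
  by rewrite expr0; lra.
rewrite exprS ler_pM2l // leNgt; apply/negP => /ltW /hmin.
by rewrite ltnn.
Qed.

(** * Interleaved sequences of complexes *)

Lemma hmap_comp_homotopic (T : finType) (K L M : {set {set T}}) (f g h : T -> T) q :
  simplicial f K L -> simplicial g L M -> simplicial h K M ->
  (forall c, c \in cycles K q ->
     push g (push f c) - push h c \in boundaries M q) ->
  forall x, hmap h K M q x = hmap g L M q (hmap f K L q x).
Proof.
move=> fKL gLM hKM fgh x; rewrite -[x]of_quotvK.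
set z := of_quotv x; have zK := subvsP z.
rewrite [hmap f K L q _]hmap_funE // [LHS]hmap_funE // [RHS]hmap_funE //.
apply/esym/eqP; rewrite to_quotv_eq [vsval (vsproj (cycles L q) _)]vsprojK.
  rewrite !vsprojK ?(push_cycles hKM) ?(push_cycles gLM) ?(push_cycles fKL) //.
  exact: fgh.
exact: push_cycles fKL _.
Qed.

(* 2k lies in [b, e] iff k lies in [uphalf b, e./2], and 2k+1 lies in [b, e] iff
   b./2 <= k < uphalf e; the predecessor in [odd_bar] is only meaningful under
   [has_odd_bar]. *)
Definition even_bar (be : nat * nat) : nat * nat := (uphalf be.1, be.2./2).
Definition has_even_bar (be : nat * nat) : bool := (uphalf be.1 <= be.2./2)%N.
Definition odd_bar (be : nat * nat) : nat * nat := (be.1./2, (uphalf be.2).-1).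
Definition has_odd_bar (be : nat * nat) : bool := (be.1./2 < uphalf be.2)%N.

(** The common index set [I] is the point: it pairs the bars of the two modules that come from the
    same summand of the interleaved one. *)
Lemma interleaved_barcodes (T : finType) (A B : nat -> {set {set T}})
    (f h a b : nat -> T -> T) m q :
  (0 < m)%N ->
  (forall k, (k < m)%N -> simplicial (a k) (A k) (B k)) ->
  (forall k, (k < m)%N -> simplicial (b k) (B k) (A k.+1)) ->
  (forall k, (k < m)%N -> simplicial (f k) (A k) (A k.+1)) ->
  (forall k, (k.+1 < m)%N -> simplicial (h k) (B k) (B k.+1)) ->
  (forall k c, (k < m)%N -> c \in cycles (A k) q ->
     push (b k) (push (a k) c) - push (f k) c \in boundaries (A k.+1) q) ->
  (forall k c, (k.+1 < m)%N -> c \in cycles (B k) q ->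
     push (a k.+1) (push (b k) c) - push (h k) c \in boundaries (B k.+1) q) ->
  exists (I : finType) (bars : I -> nat * nat),
    [/\ forall i, ((bars i).1 <= (bars i).2)%N,
        is_barcode m (homology_pmodule A f q)
          [seq even_bar (bars i) | i <- enum [pred i | has_even_bar (bars i)]]
      & is_barcode m.-1 (homology_pmodule B h q)
          [seq odd_bar (bars i) | i <- enum [pred i | has_odd_bar (bars i)]]].
Proof.
move=> m0 aAB bBA fA hB bafA abhB.
(* The sequence [A 0, B 0, A 1, ..., B m.-1, A m]. *)
pose Z k := if odd k then B k./2 else A k./2.
pose g k := if odd k then b k./2 else a k./2.
have ZA k : Z k.*2 = A k by rewrite /Z odd_double doubleK.
have ZB k : Z k.*2.+1 = B k by rewrite /Z /= odd_double /= uphalf_double.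
have ga k : g k.*2 = a k by rewrite /g odd_double doubleK.
have gb k : g k.*2.+1 = b k by rewrite /g /= odd_double /= uphalf_double.
have gZ k : (k < m.*2)%N -> simplicial (g k) (Z k) (Z k.+1).
  rewrite -(odd_double_half k); case: (odd k); rewrite ?add1n ?add0n => km.
    by rewrite gb ZB -doubleS ZA; apply: bBA; lia.
  by rewrite ga ZA ZB; apply: aAB; lia.
have [I [bars [barsN cP]]] := homology_coordinates q gZ.
exists I, bars; split; first by move=> i; case/andP: (barsN i).
- have AE : (fun k => Z (k.*2 + 0)%N) = A.
    by apply/funext => k; rewrite addn0 ZA.
  apply: (@pm_coordinates_barcode _ _ _ _
    (fun i k => ((bars i).1 <= k.*2 + 0 <= (bars i).2)%N)).
  + move=> i k km; rewrite /even_bar /has_even_bar /=; have := barsN i; lia.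
  + move=> i; rewrite /even_bar /has_even_bar /=; have := barsN i; lia.
  rewrite -AE.
  apply: (@pm_coordinates_sample _ m m.*2 0 (homology_pmodule Z g q) I bars
    (fun k => hmap (f k) (Z (k.*2 + 0)%N) (Z (k.+1.*2 + 0)%N) q)) => //.
    by rewrite addn0.
  move=> k x km; apply: hmap_comp_homotopic.
  + by apply: gZ; lia.
  + by apply: gZ; lia.
  + by rewrite !addn0 !ZA; apply: fA.
  by move=> c; rewrite !addn0 gb ga !ZA; apply: bafA.
have BE : (fun k => Z (k.*2 + 1)%N) = B.
  by apply/funext => k; rewrite addn1 ZB.
apply: (@pm_coordinates_barcode _ _ _ _
  (fun i k => ((bars i).1 <= k.*2 + 1 <= (bars i).2)%N)).
- move=> i k km; rewrite /odd_bar /has_odd_bar /=; have := barsN i; lia.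
- move=> i; rewrite /odd_bar /has_odd_bar /=; have := barsN i; lia.
rewrite -BE.
apply: (@pm_coordinates_sample _ m.-1 m.*2 1 (homology_pmodule Z g q) I bars
  (fun k => hmap (h k) (Z (k.*2 + 1)%N) (Z (k.+1.*2 + 1)%N) q)) => //.
  by lia.
move=> k x km; have km1 : (k.+1 < m)%N by lia.
apply: hmap_comp_homotopic.
- by apply: gZ; lia.
- by apply: gZ; lia.
- by rewrite !addn1 !ZB; apply: hB.
by move=> c; rewrite !addn1 -doubleS gb ga !ZB; apply: abhB.
Qed.

(** By uniqueness of barcodes both diagrams may be read off the common bars. Corresponding ends
    differ by at most one step of the scale, which is [ln (1 + eps)] in the logarithm. *)
Lemma bottleneck_even_odd (R : realType) (F : fieldType) (I : finType)
    (bars : I -> nat * nat) (alpha eps : R) N N' (M M' : pmodule F) D D' :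
  0 < alpha -> 0 <= eps -> (forall i, ((bars i).1 <= (bars i).2)%N) ->
  is_barcode N M
    [seq even_bar (bars i) | i <- enum [pred i | has_even_bar (bars i)]] ->
  is_barcode N' M'
    [seq odd_bar (bars i) | i <- enum [pred i | has_odd_bar (bars i)]] ->
  is_log_diagram (log_scale alpha eps) N M D ->
  is_log_diagram (log_scale alpha eps) N' M' D' ->
  bottleneck D D' <= ln (1 + eps).
Proof.
move=> a0 e0 barsP bM bM' [s sM ->] [s' s'M' ->].
have L0 : 0 <= ln (1 + eps) by rewrite ln_ge0 // lerDl.
apply: bottleneck_le => //.
pose pt (be : nat * nat) := log_point alpha eps be.1 be.2.+1.
have ptE t : log_points (log_scale alpha eps) t = map pt t by [].
have mapE (g : nat * nat -> nat * nat) (P : pred I) :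
    [seq (pt \o g \o bars) i | i <- enum P] = map pt [seq g (bars i) | i <- enum P].
  by rewrite -map_comp.
rewrite !ptE; apply: (@delta_matching_index _ I [pred i | has_even_bar (bars i)]
    [pred i | has_odd_bar (bars i)] (pt \o even_bar \o bars) (pt \o odd_bar \o bars)).
- by rewrite mapE perm_map // (barcode_uniq sM bM).
- by rewrite mapE perm_map // (barcode_uniq s'M' bM').
- move=> i; rewrite /= /has_even_bar /has_odd_bar => h h'; rewrite /pt /even_bar /odd_bar /=.
  by apply: linfty_log_point => //; have := barsP i; lia.
(* An unmatched bar comes from a summand supported on a single index, even here and odd in the next
   case; it is one step long. *)
- move=> i; rewrite /= /has_even_bar /has_odd_bar => h h'; rewrite /pt /even_bar /=.
  have -> : uphalf (bars i).1 = (bars i).2./2 by have := barsP i; lia.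
  exact: diagonal_dist_log_point.
move=> i; rewrite /= /has_even_bar /has_odd_bar => h h'; rewrite /pt /odd_bar /=.
have -> : (bars i).1./2 = (uphalf (bars i).2).-1 by have := barsP i; lia.
exact: diagonal_dist_log_point.
Qed.

(** * Graph induced complexes of nets *)

Section Nets.
Variables (R : realType) (X : metricType R) (V : {fset X}).
Implicit Types (u v w : V).

Lemma pdistxx v : pdist v v = 0.
Proof. exact: mdistxx. Qed.

Lemma pdistC u v : pdist u v = pdist v u.
Proof. exact: metric_sym. Qed.

Lemma pdist_triangle u v w : pdist u w <= pdist u v + pdist v w.
Proof. exact: metric_triangle. Qed.

(** A Rips complex is the clique complex of its 1-skeleton. The sign of [r] settles the pairs
    [u = v], on which a clique imposes nothing. *)
Lemma in_rips r (s : {set V}) : 0 <= r ->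
  (s \in rips V r) = (s != finset.set0) && clique (one_skeleton_graph (rips V r)) s.
Proof.
move=> r0; rewrite [LHS]inE; congr (_ && _).
apply/forall_inP/forall_inP => H u us; apply/forall_inP => v vs.
  apply/implyP => uv; rewrite /one_skeleton_graph uv inE /=.
  apply/andP; split; first by apply/set0Pn; exists u; rewrite !inE eqxx.
  have pd x y : x \in s -> y \in s -> pdist x y <= r.
    by move=> xs ys; move/forall_inP: (H x xs); apply.
  by apply/forall_inP => x; rewrite !inE => /orP[] /eqP ->;
    apply/forall_inP => y; rewrite !inE => /orP[] /eqP ->; apply: pd.
have [<-|uv] := eqVneq u v; first by rewrite pdistxx.
move/forall_inP: (H u us) => /(_ v vs); rewrite uv /= => /andP[_].
rewrite inE => /andP[_ /forall_inP/(_ u)]; rewrite !inE eqxx => /(_ isT).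
by move/forall_inP/(_ v); rewrite !inE eqxx orbT => /(_ isT).
Qed.

(** Makes the vertex map from the Rips complex to [G k] an instance of [simplicial_gic]. *)
Lemma rips_gic r : 0 <= r ->
  rips V r = graph_induced_complex (one_skeleton_graph (rips V r)) [set: V]%SET id.
Proof.
move=> r0; apply/finset.setP => s; rewrite in_rips // [RHS]inE finset.subsetT /=.
congr (_ && _); apply/idP/existsP => [cl|[t /and3P[cl _ /eqP <-]]].
  by exists s; rewrite cl eqxx imset_id eqxx.
by rewrite imset_id.
Qed.

Variables (alpha eps : R) (m : nat) (W : nat -> {set V}) (pi : nat -> V -> V).
Hypotheses (a0 : 0 < alpha) (e0 : 0 <= eps).
Hypothesis W0 : W 0%N = [set: V]%SET.
Hypothesis Wnet : forall k, (k < m)%N ->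
  is_net (alpha * eps ^+ 2 / 2 * (1 + eps) ^ (k%:Z - 1)) (W k.+1) (W k).
Hypothesis pi_near : forall k, (k < m)%N -> nearest_point_map (W k) (W k.+1) (pi k).

Let r := log_scale alpha eps.
Let G k := nets_gic W pi (r k) k.+1.

Lemma log_scale_gt0 k : 0 < r k.
Proof. by rewrite /r /log_scale mulr_gt0 // exprn_gt0 // ltr_pwDl. Qed.

Lemma log_scaleS k : r k.+1 = r k + eps * r k.
Proof. by rewrite /r /log_scale exprS; ring. Qed.

Lemma net_radiusE k :
  alpha * eps ^+ 2 / 2 * (1 + eps) ^ (k%:Z - 1) = eps ^+ 2 * r k / (2 * (1 + eps)).
Proof.
have e1 : 1 + eps != 0 by rewrite gt_eqF // ltr_pwDl.
rewrite expfzDr // exprN1 /r /log_scale -exprnP; field.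
by rewrite e1.
Qed.

Lemma pi_hat_in k v : (k < m)%N -> pi_hat pi k v \in W k.+1.
Proof.
elim: k v => [|k IH] v km /=; first by case: (pi_near km (v := v)) => //; rewrite W0 inE.
by case: (pi_near km (IH v (ltnW km))).
Qed.

Lemma pdist_pi k v : (k < m)%N -> v \in W k ->
  pdist v (pi k v) <= eps ^+ 2 * r k / (2 * (1 + eps)).
Proof.
move=> km vW; have [_ cov _] := Wnet km; have [w wW vw] := cov v vW.
rewrite -net_radiusE; apply: le_trans vw.
by have [_ h] := pi_near km vW; apply: h.
Qed.

(** The net radii are chosen so that the bound reproduces itself: [eps * r k + eps ^+ 2 * r k.+1 /
    (1 + eps) = eps * r k.+1]. *)
Lemma pdist_pi_hat k v : (k < m)%N -> 2 * pdist v (pi_hat pi k v) <= eps * r k.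
Proof.
have e1 : 0 < 1 + eps by rewrite ltr_pwDl.
have step j w : (j < m)%N -> w \in W j ->
    2 * pdist w (pi j w) <= eps ^+ 2 * r j / (1 + eps).
  move=> jm wW; have := pdist_pi jm wW.
  by rewrite invfM mulrA -(ler_pM2l (ltr0n R 2)) => /le_trans; apply; lra.
elim: k => [|k IH] km /=.
  have vW : v \in W 0%N by rewrite W0 inE.
  apply: le_trans (step _ _ km vW) _; rewrite ler_pdivrMr //.
  rewrite mulrDr mulr1 expr2 mulrAC lerDr mulr_ge0 // ltW //.
  exact: log_scale_gt0.
have := step _ _ km (pi_hat_in v (ltnW km)); have := IH (ltnW km).
have := pdist_triangle v (pi_hat pi k v) (pi k.+1 (pi_hat pi k v)).
have -> : eps ^+ 2 * r k.+1 / (1 + eps) = eps ^+ 2 * r k.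
  by rewrite log_scaleS; field; rewrite gt_eqF.
rewrite log_scaleS; move: (pdist _ _) (pdist _ _) (pdist _ _) (r k) => a b c d.
lra.
Qed.

(** The nets are nested, and a point that stays in the next net is its own nearest point. *)
Lemma pi_hat_id k v : (k < m)%N -> v \in W k.+1 -> pi_hat pi k v = v.
Proof.
have pi_id j w : (j < m)%N -> w \in W j.+1 -> w \in W j -> pi j w = w.
  move=> jm w1 w0; have [_ /(_ w w1)] := pi_near jm w0; rewrite pdistxx => h.
  apply/val_inj/esym/(@mdist_positivity R X)/eqP; rewrite eq_le mdist_ge0 andbT.
  exact: h.
elim: k => [|k IH] km vW /=; first by apply: pi_id; rewrite // W0 inE.
have [/fintype.subsetP/(_ v vW) vW' _ _] := Wnet km.
by rewrite IH ?(ltnW km) // pi_id.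
Qed.

Lemma pdist_pi_hat2 k u v : (k < m)%N -> pdist u v <= r k ->
  pdist (pi_hat pi k u) (pi_hat pi k v) <= r k.+1.
Proof.
move=> km uv; have := pdist_pi_hat u km; have := pdist_pi_hat v km.
have := pdist_triangle (pi_hat pi k u) u (pi_hat pi k v).
have := pdist_triangle u v (pi_hat pi k v).
rewrite (pdistC (pi_hat pi k u) u) log_scaleS; lra.
Qed.

Lemma pdist_pi_hat1 k u v : (k < m)%N -> pdist u v <= r k ->
  pdist u (pi_hat pi k v) <= r k.+1.
Proof.
move=> km uv; have := pdist_pi_hat v km.
have := pdist_triangle u v (pi_hat pi k v).
have : 0 <= eps * r k by rewrite mulr_ge0 // ltW ?log_scale_gt0.
rewrite log_scaleS; lra.
Qed.

(** * The interleaving of Rips and graph induced complexes *)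

Lemma simplicial_rips_gic k : (k < m)%N -> simplicial (pi_hat pi k) (rips V (r k)) (G k).
Proof.
move=> km; rewrite rips_gic ?ltW ?log_scale_gt0 //.
by apply: (@simplicial_gic _ _ _ _ _ id) => // v _; apply: pi_hat_in.
Qed.

Lemma gic_sub_rips k s : (k < m)%N -> s \in G k -> s \in rips V (r k.+1).
Proof.
move=> km; rewrite inE => /and3P[s0 _ /existsP[t /and3P[cl _ /eqP ts]]].
rewrite inE s0 -ts; have : t \in rips V (r k).
  rewrite in_rips ?ltW ?log_scale_gt0 // cl andbT.
  by apply: contraNneq s0 => t0; rewrite -ts t0 imset0.
rewrite inE => /andP[_ /forall_inP tr].
apply/forall_inP => _ /imsetP[u ut ->]; apply/forall_inP => _ /imsetP[v vt ->].
by apply: pdist_pi_hat2 => //; move/forall_inP: (tr u ut); apply.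
Qed.

Lemma simplicial_gic_rips k : (k < m)%N -> simplicial id (G k) (rips V (r k.+1)).
Proof. by move=> km; apply/forall_inP => s /gic_sub_rips; rewrite imset_id; apply. Qed.

Lemma rips_sub r' (s t : {set V}) :
  s \in rips V r' -> t \subset s -> t != finset.set0 -> t \in rips V r'.
Proof.
rewrite !inE => /andP[_ /forall_inP sr] /fintype.subsetP ts -> /=.
apply/forall_inP => u /ts us; apply/forall_inP => v /ts vs.
by move/forall_inP: (sr u us); apply.
Qed.

Lemma pi_hat_contiguous_id q k c : (k < m)%N -> c \in cycles (rips V (r k)) q ->
  push (pi_hat pi k) c - push id c \in boundaries (rips V (r k.+1)) q.
Proof.
move=> km; apply: contiguous_push.
- by move=> s t; apply: rips_sub.
- move=> s; rewrite !inE imset_id => /andP[/set0Pn[x xs] /forall_inP sr].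
  have sP u v : u \in s -> v \in s -> pdist u v <= r k.
    by move=> us; move/forall_inP: (sr u us); apply.
  have rk : r k <= r k.+1 by rewrite log_scaleS lerDl mulr_ge0 // ltW ?log_scale_gt0.
  apply/andP; split; first by apply/set0Pn; exists x; rewrite inE xs orbT.
  apply/forall_inP => u; rewrite inE => /orP[/imsetP[u' us ->]|us];
    apply/forall_inP => v; rewrite inE => /orP[/imsetP[v' vs ->]|vs].
  + by rewrite pdist_pi_hat2 // sP.
  + by rewrite pdistC pdist_pi_hat1 // sP.
  + by rewrite pdist_pi_hat1 // sP.
  + exact: le_trans (sP _ _ us vs) rk.
- by rewrite inE eqxx.
Qed.

(** The vertices of [G k] lie in [W k.+1], where [pi_hat pi k] is the identity; so this composite
    agrees with the given map already on chains, without a homotopy. *)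
Lemma pi_hat_pi_cycle q k c : (k.+1 < m)%N -> c \in cycles (G k) q ->
  push (pi_hat pi k.+1) c = push (pi k.+1) c.
Proof.
move=> km; rewrite memv_cap => /andP[/chainsP cG _]; apply: eq_push => s /cG/andP[].
rewrite inE => /and3P[_ /fintype.subsetP sW _] _ x /sW xW /=.
by rewrite pi_hat_id // ltnW.
Qed.

Lemma simplicial_pi k : (k.+1 < m)%N -> simplicial (pi k.+1) (G k) (G k.+1).
Proof.
move=> km; apply: simplicial_nets_gic.
  by rewrite log_scaleS lerDl mulr_ge0 // ltW ?log_scale_gt0.
by move=> v vW; case: (pi_near km vW).
Qed.

Lemma nets_log_approximated c : (0 < m)%N -> ln (1 + eps) <= c ->
  log_approximated r c m (homology_pmodule (fun k => rips V (r k)) (fun=> id))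
    m.-1 (homology_pmodule G (fun k => pi k.+1)).
Proof.
move=> m0 lec q.
have [|||||||I [bars [barsP bR bG]]] := @interleaved_barcodes V
    (fun k => rips V (r k)) G (fun=> id) (fun k => pi k.+1) (pi_hat pi) (fun=> id) m q.
- by [].
- exact: simplicial_rips_gic.
- exact: simplicial_gic_rips.
- move=> k km; apply: simplicial_rips.
  by rewrite log_scaleS lerDl mulr_ge0 // ltW ?log_scale_gt0.
- exact: simplicial_pi.
- by move=> k z km zR; rewrite (push_id (push _ _)) pi_hat_contiguous_id.
- by move=> k z km zG; rewrite (push_id z) (pi_hat_pi_cycle km zG) subrr mem0v.
split; first by eexists; eexists; first exact: bR.
  by eexists; eexists; first exact: bG.
move=> D D' DR DG; apply: le_trans lec.
exact: (bottleneck_even_odd a0 e0 barsP bR bG).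
Qed.

(** * Size of the skeleta *)

Lemma card_nbr_le d k v : 0 < eps <= 1 -> 0 <= d -> half_coverable X d ->
  (k < m)%N ->
  #|finset (fun u => (u \in W k.+1) && (pdist v u <= r k.+1))|%:R
    <= (128 * eps^-1 ^+ 2) `^ d.
Proof.
move=> /andP[eps0 eps1] d0 cov km.
have ei1 : 1 <= eps^-1 by rewrite invf_ge1.
(* [y] lies between [1 / eps] and [2 / eps]. With [h.*2 + 5] halvings the radius is divided by
   [32 * y ^+ 2], which is at most [128 * eps^-1 ^+ 2]. *)
have [h /andP[yl yu]] := exists_dyadic_bracket ei1; set y : R := 2 ^+ h in yl yu.
have y0 : 0 < y by rewrite exprn_gt0.
have jE : 2 ^+ (h.*2 + 5) = 32 * y ^+ 2 :> R.
  by rewrite exprD -muln2 exprM mulrC; congr (_ * _); rewrite -natrX.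
have rk := log_scale_gt0 k.
apply: (@le_trans _ _ ((2 `^ d) ^+ (h.*2 + 5))); last first.
  have -> : (2 `^ d) ^+ (h.*2 + 5) = (2 ^+ (h.*2 + 5)) `^ d :> R.
    by rewrite -[LHS]powR_mulrn ?powR_ge0 // powRAC powR_mulrn.
  have ei0 : 0 <= eps^-1 by rewrite invr_ge0 ltW.
  apply: (ge0_ler_powR d0); rewrite ?nnegrE ?exprn_ge0 ?mulr_ge0 ?exprn_ge0 //.
  rewrite jE; have : y ^+ 2 <= (2 * eps^-1) ^+ 2.
    by rewrite lerXn2r ?nnegrE ?mulr_ge0 // ltW.
  by rewrite exprMn; lra.
have [_ _ sep] := Wnet km.
(* The radius is doubled because the balls are open while the neighbours satisfy a weak
   inequality. *)
apply: (packing_bound cov (x := val v) (r := 2 * r k.+1)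
  (delta := eps ^+ 2 * r k / (2 * (1 + eps)))).
- by rewrite mulr_gt0 // log_scale_gt0.
- rewrite jE log_scaleS.
  have ey : 1 <= eps * y by rewrite -ler_pdivrMl // mulr1.
  rewrite ler_pdivrMr ?mulr_gt0 ?exprn_gt0 //.
  have -> : eps ^+ 2 * r k / (2 * (1 + eps)) / 2 * (32 * y ^+ 2) =
      8 * (eps * y) ^+ 2 * r k / (1 + eps).
    by field; rewrite gt_eqF // ltr_pwDl.
  rewrite ler_pdivlMr ?ltr_pwDl //.
  (* What remains is [(1 + eps) ^+ 2 <= 4 * (eps * y) ^+ 2], from [1 + eps <= 2] and
     [1 <= eps * y]. *)
  have -> : 2 * (r k + eps * r k) * (1 + eps) = 2 * (1 + eps) ^+ 2 * r k by ring.
  rewrite ler_pM2r //.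
  have : 1 <= (eps * y) ^+ 2 by rewrite exprn_ege1.
  have : (1 + eps) ^+ 2 <= 2 ^+ 2 by rewrite lerXn2r ?nnegrE ?addr_ge0 //; lra.
  lra.
- move=> u; rewrite inE => /andP[_ uv]; apply: le_lt_trans uv _.
  by have := log_scale_gt0 k.+1; lra.
by move=> u w; rewrite !inE => /andP[uW _] /andP[wW _] uw; rewrite -net_radiusE sep.
Qed.

Lemma card_skeleton_nets_gic_le d p k : 0 < eps <= 1 -> 0 <= d ->
  half_coverable X d -> (k < m)%N ->
  #|skeleton p (G k)|%:R
    <= 128 `^ (d * p%:R) * eps^-1 `^ (2%:R * d * p%:R) * #|` V|%:R.
Proof.
move=> eps01 d0 cov km; have /andP[eps0 _] := eps01.
pose nbr v := finset (fun u => (u \in W k.+1) && (pdist v u <= r k.+1)).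
apply: (@le_trans _ _ (\sum_(v : V) #|nbr v| ^ p)%N%:R).
  rewrite ler_nat; apply: card_skeleton_le => s sG.
  have := gic_sub_rips km sG; rewrite inE => /andP[s0 /forall_inP sr].
  split=> // v vs; apply/fintype.subsetP => u us; rewrite inE.
  have -> : u \in W k.+1.
    by move: sG; rewrite inE => /and3P[_ /fintype.subsetP sW _]; apply: sW.
  by move/forall_inP: (sr v vs) => /(_ u us).
set B := 128 * eps^-1 ^+ 2.
have -> : 128 `^ (d * p%:R) * eps^-1 `^ (2%:R * d * p%:R) = (B `^ d) ^+ p.
  rewrite -powR_mulrn ?powR_ge0 // -powRrM /B powRM ?exprn_ge0 ?invr_ge0 ?ltW //.
  by rewrite -[in RHS](@powR_mulrn _ eps^-1) ?invr_ge0 ?ltW // -powRrM mulrA.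
rewrite natr_sum; apply: (@le_trans _ _ (\sum_(v : V) (B `^ d) ^+ p)).
  apply: ler_sum => v _; rewrite natrX lerXn2r ?nnegrE ?powR_ge0 //.
  exact: card_nbr_le.
by rewrite sumr_const cardfE mulr_natr.
Qed.

End Nets.

Theorem theorem6p5 :
  exists c : nat, forall R : realType, exists C : R -> nat -> R,
  forall (X : metricType R) (d : R) (V : {fset X}) (alpha eps : R) (m : nat)
    (W : nat -> {set V}) (pi : nat -> V -> V),
  doubling_dimension X d ->
  0 < alpha -> 0 <= eps <= 1 -> (0 < m)%N ->
  W 0%N = [set: V]%SET ->
  (forall k, (k < m)%N ->
     is_net (alpha * eps ^+ 2 / 2 * (1 + eps) ^ (k%:Z - 1)) (W k.+1) (W k)) ->
  (forall k, (k < m)%N -> nearest_point_map (W k) (W k.+1) (pi k)) ->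
  let r := log_scale alpha eps in
  let G := fun k => nets_gic W pi (r k) k.+1 in
  log_approximated r (3 * ln (1 + eps) / 2)
    m (homology_pmodule (fun k => rips V (r k)) (fun=> id))
    m.-1 (homology_pmodule G (fun k => pi k.+1)) /\
  (0 < eps -> forall p k, (k < m)%N ->
     #|skeleton p (G k)|%:R
       <= C d p * (eps^-1 `^ (c%:R * d * p%:R)) * #|` V|%:R).
Proof.
exists 2%N => R; exists (fun d p => 128 `^ (d * p%:R)).
move=> X d V alpha eps m W pi [d0 cov _] a0 /andP[e0 e1] m0 W0 Wnet pi_near r G.
split=> [|eps0 p k km].
  apply: nets_log_approximated => //.
  (* The matching achieves [ln (1 + eps)], which is below the claimed bound. *)
  have : 0 <= ln (1 + eps) by rewrite ln_ge0 // lerDl.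
  lra.
by apply: (card_skeleton_nets_gic_le (m := m)) => //; rewrite eps0 e1.
Qed.
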